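(* Let $d\ge2$ and let $T\subset\mathbb R^d$ be a $d$-simplex. Let $$\Sigma_{1^{++}}(T;\mathbb S)=\mathbb P_1(T;\mathbb S)\oplus\operatorname{sym}(\boldsymbol x\otimes\mathbb H_1(T;\mathbb R^d))\oplus\boldsymbol x\boldsymbol x^{\intercal}\mathbb H_1(T).$$ The following degrees of freedom are unisolvent for $\Sigma_{1^{++}}(T;\mathbb S)$: (a) $(\operatorname{tr}_e(\boldsymbol\tau),q)_e$, for $q\in\mathbb P_1(e)$, $e\in\Delta_{d-2}(T)$; (b) $(\boldsymbol n^{\intercal}\boldsymbol\tau\boldsymbol n,q)_F$, for $q\in\mathbb P_1(F)$, $F\in\Delta_{d-1}(T)$; (c) $(\operatorname{tr}_2(\boldsymbol\tau),q)_F$, for $q\in\mathbb P_1(F)$, $F\in\Delta_{d-1}(T)$.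
   Context: $\mathbb S$ is the space of symmetric real $d\times d$ matrices. $\mathbb P_k(D)$ is the space of polynomials of total degree at most $k$ on $D$, $\mathbb H_k(D)$ the homogeneous polynomials of degree $k$, $\mathbb P_k(D;\mathbb X)=\mathbb P_k(D)\otimes\mathbb X$ and likewise for $\mathbb H_k$. $\boldsymbol x\otimes\boldsymbol q=\boldsymbol x\boldsymbol q^{\intercal}$. $(\cdot,\cdot)_D$ is the $L^2$ inner product on $D$ (product of point values if $D$ is a point). $\Delta_\ell(T)$ is the set of $\ell$-dimensional subsimplices of $T$. $\operatorname{div}$ acts row-wise on matrices. For $F\in\Delta_{d-1}(T)$, $\boldsymbol n=\boldsymbol n_{\partial T}|_F$ is the unit normal of $F$ outward to $T$, $\Pi_F=\boldsymbol I-\boldsymbol n\boldsymbol n^{\intercal}$, and $\operatorname{div}_F\boldsymbol v$ is the surface divergence of $\Pi_F\boldsymbol v$. For $e\in\Delta_{d-2}(T)$ with $e\subset\partial F$, $\boldsymbol n_{F,e}$ is the unit vector tangent to $F$, normal to $e$ and pointing outward from $F$. $\operatorname{tr}_2(\boldsymbol\tau)=\boldsymbol n^{\intercal}\operatorname{div}\boldsymbol\tau+\operatorname{div}_F(\boldsymbol\tau\boldsymbol n)$ on each $F$, and $\operatorname{tr}_e(\boldsymbol\tau)=\sum_{F\in\Delta_{d-1}(T),\,e\subset\partial F}\boldsymbol n_{F,e}^{\intercal}\boldsymbol\tau\,\boldsymbol n_{\partial T}|_F$ on $e$. ''Unisolvent'' means: letting the test functions run through bases of the test spaces, the number of functionals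 equals $\dim\Sigma_{1^{++}}(T;\mathbb S)$, and $\boldsymbol\tau\in\Sigma_{1^{++}}(T;\mathbb S)$ vanishes if all functionals vanish on it. *)

(* Defs.v *)
From HB Require Import structures.
From mathcomp Require Import all_boot all_order all_algebra.
From mathcomp Require Import all_classical all_reals all_analysis.
From mathcomp Require Import ring lra.
(* the notations of mpoly clash with those of MathComp-Analysis *)
From mathcomp Require mpoly.
Import -(notations) mpoly.

Set Implicit Arguments.
Unset Strict Implicit.
Unset Printing Implicit Defensive.

Import Order.TTheory GRing.Theory Num.Theory.
Import numFieldNormedType.Exports.

Local Open Scope classical_set_scope.
Local Open Scope ring_scope.

Section Dimension.
Context {R : realType} {V : lmodType R}.

Definition is_basis (W : set V) (n : nat) (b : 'I_n -> V) : Prop :=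
  (forall c : 'I_n -> R, \sum_(i < n) c i *: b i = 0 -> forall i, c i = 0) /\
  W = [set w | exists c : 'I_n -> R, w = \sum_(i < n) c i *: b i].

Definition has_dim (W : set V) (n : nat) : Prop :=
  exists b : 'I_n -> V, is_basis W b.

End Dimension.

(* A family, indexed by j : J, of bilinear pairings [dof j] of [Sigma] with a
   test space [Q j]; it yields dim (Q j) functionals for each j. The first
   conjunct (the test spaces are finite dimensional) says that the bases
   quantified over in the second one exist. *)
Definition unisolvent {R : realType} {V U : lmodType R} (Sigma : set V)
    (J : finType) (Q : J -> set U) (dof : J -> V -> U -> R) : Prop :=
  (forall j, exists m, has_dim (Q j) m) /\
  (forall (m : J -> nat) (b : forall j, 'I_(m j) -> U),
    (forall j, is_basis (Q j) (b j)) ->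
    has_dim Sigma (\sum_(j : J) m j)%N /\
    (forall tau, Sigma tau ->
      (forall (j : J) (i : 'I_(m j)), dof j tau (b j i) = 0) -> tau = 0)).

Section Polynomials.
Context {R : realType} {d : nat}.

Definition polyfun (p : mpoly d R) (x : 'cV[R]_d) : R :=
  meval (fun i => x i 0) p.

(* A polynomial on D is a function on D, represented by its extension by 0 to
   R^d: [Pk k D] is linearly isomorphic to the space of the restrictions to D
   of polynomials of total degree at most k. *)
Definition Pk (k : nat) (D : set 'cV[R]_d) : set ('cV[R]_d -> R) :=
  [set f | exists2 p : mpoly d R,
     (mmeasure mdeg p <= k.+1)%N & f = polyfun p \_ D].

Definition Hk (k : nat) (D : set 'cV[R]_d) : set ('cV[R]_d -> R) :=
  [set f | exists2 p : mpoly d R,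
     p \is @ishomog1 d R k mdeg & f = polyfun p \_ D].

End Polynomials.

Section ShapeFunctions.
Context (R : realType) (d : nat).

(* As the simplex T has nonempty interior, a polynomial on T is identified with
   the polynomial on R^d that extends it. *)

Definition Pk_sym (k : nat) : set ('cV[R]_d -> 'M[R]_d) :=
  [set tau : 'cV[R]_d -> 'M[R]_d | (forall i j, Pk k setT (fun x => tau x i j)) /\
             (forall x, (tau x)^T = tau x)].

Definition Hk_vec (k : nat) : set ('cV[R]_d -> 'cV[R]_d) :=
  [set q : 'cV[R]_d -> 'cV[R]_d | forall i, Hk k setT (fun x => q x i 0)].

Definition sym (A : 'M[R]_d) : 'M[R]_d := 2^-1 *: (A + A^T).

Definition sym_x_H1 : set ('cV[R]_d -> 'M[R]_d) :=
  [set tau | exists2 q, Hk_vec 1 q & tau = (fun x => sym (x *m (q x)^T))].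

Definition xxT_H1 : set ('cV[R]_d -> 'M[R]_d) :=
  [set tau | exists2 q, Hk 1 setT q & tau = (fun x => q x *: (x *m x^T))].

Definition Sigma1pp : set ('cV[R]_d -> 'M[R]_d) :=
  [set tau | exists t1 t2 t3, [/\ Pk_sym 1 t1, sym_x_H1 t2, xxT_H1 t3 &
                                  tau = t1 + t2 + t3]].

Lemma polyfun_scale (p : mpoly d R) (s : R) (x : 'cV[R]_d) :
  polyfun p (s *: x) =
  \sum_(m <- msupp p) mcoeff m p * (s ^+ mdeg m * \prod_i x i 0 ^+ m i).
Proof.
rewrite /polyfun mevalE; apply: eq_bigr => m _; congr (_ * _).
under eq_bigr => i _ do rewrite mxE exprMn.
by rewrite big_split /= -expr_sum mdegE.
Qed.

Lemma Pk1_scale (f : 'cV[R]_d -> R) (s : R) (x : 'cV[R]_d) :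
  Pk 1 setT f -> f (s *: x) = s * f x - (s - 1) * f 0.
Proof.
move=> [p hp ->]; rewrite patch_setT.
have := polyfun_scale p 0 x; rewrite scale0r => ->.
have := polyfun_scale p 1 x; rewrite scale1r => ->.
rewrite polyfun_scale !mulr_sumr -sumrB.
apply: eq_big_seq => m /(msize_mdeg_lt) hm.
have : (mdeg m < 2)%N by exact: leq_trans hm hp.
case: (mdeg m) => [|[|//]] _; rewrite ?expr0 ?expr1; ring.
Qed.

Lemma Hk_scale (k : nat) (f : 'cV[R]_d -> R) (s : R) (x : 'cV[R]_d) :
  Hk k setT f -> f (s *: x) = s ^+ k * f x.
Proof.
move=> [p /dhomogP hp ->]; rewrite patch_setT.
have := polyfun_scale p 1 x; rewrite scale1r => ->.
rewrite polyfun_scale mulr_sumr.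
apply: eq_big_seq => m /hp /= ->; rewrite expr1n; ring.
Qed.

Lemma Sigma1pp_direct t1 t2 t3 :
  Pk_sym 1 t1 -> sym_x_H1 t2 -> xxT_H1 t3 -> t1 + t2 + t3 = 0 ->
  [/\ t1 = 0, t2 = 0 & t3 = 0].
Proof.
move=> [h1 _] [q2 h2 e2] [q3 h3 e3] h.
have s2 s x i j : t2 (s *: x) i j = s ^+ 2 * t2 x i j.
  rewrite e2 /sym !mxE !big_ord1 !mxE !(Hk_scale _ _ (h2 _)); ring.
have s3 s x i j : t3 (s *: x) i j = s ^+ 3 * t3 x i j.
  rewrite e3 !mxE !big_ord1 !mxE !(Hk_scale _ _ h3); ring.
have hs s x i j : s * t1 x i j - (s - 1) * t1 0 i j + s ^+ 2 * t2 x i j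
                  + s ^+ 3 * t3 x i j = 0.
  have /matrixP/(_ i j) := congr1 (fun t => t (s *: x)) h.
  by rewrite !mxE s2 s3 (Pk1_scale s x (h1 i j)).
have t0 x i j : [/\ t1 x i j = 0, t2 x i j = 0 & t3 x i j = 0].
  have := hs 0 x i j; have := hs 1 x i j; have := hs 2 x i j; have := hs 3 x i j.
  move: (t1 x i j) (t1 0 i j) (t2 x i j) (t3 x i j) => a b c e *; split; lra.
by split; apply/funext => x; apply/matrixP => i j;
  have [h1' h2' h3'] := t0 x i j; rewrite ?h1' ?h2' ?h3' mxE.
Qed.

End ShapeFunctions.

Definition dot {R : realType} {d : nat} (u w : 'cV[R]_d) : R :=
  \sum_(i < d) u i 0 * w i 0.

(* An l-dimensional subsimplex is given by its set of l + 1 vertices. *)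
Definition subsimplex (d l : nat) : Type :=
  {A : {set 'I_d.+1} | #|A| == l.+1}.

Section Simplex.
Context {R : realType} {d : nat}.
Variable v : 'I_d.+1 -> 'cV[R]_d.

Definition affinely_independent : Prop :=
  forall c : 'I_d.+1 -> R,
    \sum_i c i = 0 -> \sum_i c i *: v i = 0 -> forall i, c i = 0.

Definition hull (A : {set 'I_d.+1}) : set 'cV[R]_d :=
  [set x | exists c : 'I_d.+1 -> R,
     [/\ forall i, i \in A -> 0 <= c i, \sum_(i in A) c i = 1 &
         x = \sum_(i in A) c i *: v i]].

Definition tangent (A : {set 'I_d.+1}) (u : 'cV[R]_d) : Prop :=
  exists2 c : 'I_d.+1 -> R,
    \sum_(i in A) c i = 0 & u = \sum_(i in A) c i *: v i.

(* n is the unit vector tangent to the subsimplex A, normal to its facet B and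
   pointing outward from A. *)
Definition is_outward_normal (A B : {set 'I_d.+1}) (n : 'cV[R]_d) : Prop :=
  [/\ tangent A n,
      forall u, tangent B u -> dot n u = 0,
      dot n n = 1 &
      forall i j, i \in A -> i \notin B -> j \in B -> dot n (v i - v j) < 0].

(* It exists and is unique when v is affinely independent, B is included in A
   and B has one vertex less than A. *)
Definition outward_normal (A B : {set 'I_d.+1}) : 'cV[R]_d :=
  xget 0 [set n | is_outward_normal A B n].

Definition facet_normal (F : {set 'I_d.+1}) : 'cV[R]_d :=
  outward_normal [set: 'I_d.+1]%SET F.

(* Lebesgue integral of f over {t in R^l | t_i >= 0, t_1 + ... + t_l <= s}, as
   an iterated integral (Fubini). *)
Fixpoint simplex_integral (l : nat) (s : R) (f : seq R -> R) : R :=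
  if l is l'.+1 then
    \int[lebesgue_measure]_(t in `[0, s])
      simplex_integral l' (s - t) (fun u => f (t :: u))
  else f [::].

Definition vertex (A : {set 'I_d.+1}) (k : nat) : 'cV[R]_d :=
  v (nth ord0 (enum A) k).

Definition edge (A : {set 'I_d.+1}) (k : nat) : 'cV[R]_d :=
  vertex A k.+1 - vertex A 0.

Definition param (A : {set 'I_d.+1}) (l : nat) (t : seq R) : 'cV[R]_d :=
  vertex A 0 + \sum_(k < l) t`_k *: edge A k.

Definition gram (A : {set 'I_d.+1}) (l : nat) : 'M[R]_l :=
  \matrix_(i, j) dot (edge A i) (edge A j).

(* Integral of f * g against the l-dimensional surface measure; sqrt (det gram)
   is the volume element of the affine parametrization [param]. For l = 0 this
   is the product of the values at the vertex. *)
Definition L2 (l : nat) (A : subsimplex d l) (f g : 'cV[R]_d -> R) : R :=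
  Num.sqrt (\det (gram (val A) l)) *
  simplex_integral l 1
    (fun t => f (param (val A) l t) * g (param (val A) l t)).

Definition partial (j : 'I_d) (f : 'cV[R]_d -> R) (x : 'cV[R]_d) : R :=
  'D_(delta_mx j 0) f x.

Definition divmx (tau : 'cV[R]_d -> 'M[R]_d) (x : 'cV[R]_d) : 'cV[R]_d :=
  \col_i \sum_j partial j (fun y => tau y i j) x.

Definition tproj (n : 'cV[R]_d) : 'M[R]_d := 1%:M - n *m n^T.

(* Surface divergence, on a hyperplane with unit normal n, of the tangential
   part of w: trace of the tangential gradient of (tproj n) w. *)
Definition surface_div (n : 'cV[R]_d) (w : 'cV[R]_d -> 'cV[R]_d)
    (x : 'cV[R]_d) : R :=
  \sum_i \sum_j
    tproj n i j * partial j (fun y => (tproj n *m w y) i 0) x.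

Definition tr_nn (F : {set 'I_d.+1}) (tau : 'cV[R]_d -> 'M[R]_d)
    (x : 'cV[R]_d) : R :=
  dot (facet_normal F) (tau x *m facet_normal F).

Definition tr_2 (F : {set 'I_d.+1}) (tau : 'cV[R]_d -> 'M[R]_d)
    (x : 'cV[R]_d) : R :=
  dot (facet_normal F) (divmx tau x) +
  surface_div (facet_normal F) (fun y => tau y *m facet_normal F) x.

Definition tr_e (e : {set 'I_d.+1}) (tau : 'cV[R]_d -> 'M[R]_d)
    (x : 'cV[R]_d) : R :=
  \sum_(F : {set 'I_d.+1} | (#|F| == d) && (e \subset F))
    dot (outward_normal F e) (tau x *m facet_normal F).

Definition dof_index : finType :=
  (subsimplex d d.-2 + subsimplex d d.-1 + subsimplex d d.-1)%type.

Definition dof_space (a : dof_index) : set ('cV[R]_d -> R) :=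
  match a with
  | inl (inl e) => Pk 1 (hull (val e))
  | inl (inr F) => Pk 1 (hull (val F))
  | inr F => Pk 1 (hull (val F))
  end.

Definition dof (a : dof_index) (tau : 'cV[R]_d -> 'M[R]_d)
    (q : 'cV[R]_d -> R) : R :=
  match a with
  | inl (inl e) => L2 e (tr_e (val e) tau) q
  | inl (inr F) => L2 F (tr_nn (val F) tau) q
  | inr F => L2 F (tr_2 (val F) tau) q
  end.

End Simplex.

(* Main.v *)
(* Let lam_k be the barycentric coordinates of T. Since both constant vectors and
   x itself are combinations of the vectors v_i - x with constant coefficients,
   the shape functions are exactly the fields
     tau(x) = sum_ij B_ij(x) (v_i - x)(v_j - x)^T,   B_ij = sum_k b_ijk lam_k,
   with b symmetric in i, j; as sum_k lam_k(x) (v_k - x) = 0, one may normalize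
   b_iii = 0, and the remaining coefficients are as many as the degrees of freedom.
   On the facet F_i opposite to v_i, with h the height of v_i, the traces are
   n^T tau n = h^2 B_ii and, once B_ii = 0,
   tr_2 = 2 h ((d + 1) sum_l B_il - sum_l b_ill); on the subsimplex opposite to
   v_i and v_j, tr_e is a positive multiple of B_ij once B_ii = B_jj = 0. All of
   them are affine, so they vanish when their moments do: the L2 product of two
   affine functions f, g on an l-simplex with vertices w_k is
   vol / ((l + 1)(l + 2)) (sum_k f(w_k) g(w_k) + sum_k f(w_k) sum_k g(w_k)).
   Then b_iik = 0, b_ijk = 0 for distinct i, j, k, and (d + 1) b_ikk = sum_l b_ill
   for all k <> i; summing over the d indices k gives sum_l b_ill = 0 and b = 0. *)
Require Import Defs.
From mathcomp Require Import all_boot all_order all_algebra.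
From mathcomp Require Import all_classical all_reals all_analysis.
From mathcomp Require Import ring lra zify.
From mathcomp Require mpoly.
Import -(notations) mpoly.

Set Implicit Arguments.
Unset Strict Implicit.
Unset Printing Implicit Defensive.

Import Order.TTheory GRing.Theory Num.Theory.
Import numFieldNormedType.Exports.

Local Open Scope ring_scope.

(** * Bases and dimension of a subspace *)

Section Dimension.
Context {R : realType} {V : lmodType R}.

(** Expanding each basis in the other gives matrices C and C' with C C' = 1 by freeness, which
    forces m <= m'. Unisolvence quantifies over arbitrary bases of the test spaces, so their sizes
    must be shown to be determined. *)
Lemma is_basis_unique_size (W : set V) n n' (b : 'I_n -> V) (b' : 'I_n' -> V) :
  is_basis W b -> is_basis W b' -> n = n'.
Proof.
suff le m m' (a : 'I_m -> V) (a' : 'I_m' -> V) :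
    is_basis W a -> is_basis W a' -> (m <= m')%N.
  by move=> hb hb'; apply/eqP; rewrite eqn_leq (le _ _ _ _ hb hb') (le _ _ _ _ hb' hb).
move=> [fa Wa] [fa' Wa'].
have in_span k (e : 'I_k -> V) i : exists c : 'I_k -> R, e i = \sum_j c j *: e j.
  exists (fun j => (i == j)%:R); rewrite (bigD1 i) //= eqxx scale1r big1 ?addr0 //.
  by move=> j; rewrite eq_sym => /negbTE->; rewrite scale0r.
have h i : exists c : 'I_m' -> R, a i = \sum_j c j *: a' j.
  by have : W (a i) by [rewrite Wa; exact: in_span]; rewrite Wa'.
have h' j : exists c : 'I_m -> R, a' j = \sum_i c i *: a i.
  by have : W (a' j) by [rewrite Wa'; exact: in_span]; rewrite Wa.
have [C hC] := choice h; have [C' hC'] := choice h'.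
apply: (@mulmx1_min R m m' (\matrix_(i, j) C i j) (\matrix_(i, j) C' i j)).
apply/matrixP => i k; rewrite !mxE.
under eq_bigr => j _ do rewrite !mxE.
apply/eqP; rewrite -subr_eq0; apply/eqP.
apply: (fa (fun k => \sum_j C i j * C' j k - (i == k)%:R)).
under eq_bigr => l _ do rewrite scalerBl scaler_suml.
rewrite sumrB exchange_big /= [X in _ - X](bigD1 i) //= eqxx scale1r.
rewrite [X in _ - (_ + X)]big1 ?addr0; last first.
  by move=> l; rewrite eq_sym => /negbTE->; rewrite scale0r.
apply/eqP; rewrite subr_eq0 (hC i); apply/eqP; apply: eq_bigr => j _.
by rewrite (hC' j) scaler_sumr; apply: eq_bigr => l _; rewrite scalerA.
Qed.

(** Lets the vertices of a face, or triples of vertices, index a basis in place of an ordinal. *)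
Lemma has_dim_family (I : finType) (K : {set I}) (W : set V) (e : I -> V) :
    (forall c : I -> R, \sum_(i in K) c i *: e i = 0 -> forall i, i \in K -> c i = 0) ->
    (forall w, W w <-> exists c : I -> R, w = \sum_(i in K) c i *: e i) ->
  has_dim W #|K|.
Proof.
move=> free span; exists (fun i => e (enum_val i)).
(* The coefficients are carried to [I] along the enumeration of [K]; its inverse needs an element of
   [K], so the empty set is treated apart. *)
have ext (c : 'I_#|K| -> R) : exists c' : I -> R, forall i, c i = c' (enum_val i).
  case: (posnP #|K|) => [K0|K0].
    by exists (fun=> 0) => i; have := ltn_ord i; rewrite [X in (_ < X)%N]K0.
  have hx := enum_valP (Ordinal K0).
  by exists (fun x => c (enum_rank_in hx x)) => i; rewrite enum_valK_in.
split => [c|].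
  have [c' hc'] := ext c.
  under eq_bigr => i _ do rewrite hc'.
  rewrite -(big_enum_val (fun i => c' i *: e i)) => h i.
  by rewrite hc'; apply: free h _ _; exact: enum_valP.
apply/seteqP; split => w /=.
  move=> /span[c ->]; exists (fun i => c (enum_val i)).
  by rewrite (big_enum_val (fun i => c i *: e i)).
move=> [c ->]; apply/span; have [c' hc'] := ext c; exists c'.
by rewrite (big_enum_val (fun i => c' i *: e i)); apply: eq_bigr => i _; rewrite hc'.
Qed.

End Dimension.

(** * The Euclidean inner product *)

Section Dot.
Context {R : realType} {d : nat}.
Implicit Types u w p q : 'cV[R]_d.

Lemma dotC u w : dot u w = dot w u.
Proof. by apply: eq_bigr => i _; rewrite mulrC. Qed.

Lemma dotDr u w p : dot u (w + p) = dot u w + dot u p.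
Proof. by rewrite -big_split; apply: eq_bigr => i _; rewrite mxE mulrDr. Qed.

Lemma dotZr a u w : dot u (a *: w) = a * dot u w.
Proof. by rewrite mulr_sumr; apply: eq_bigr => i _; rewrite mxE; ring. Qed.

Lemma dot0r u : dot u 0 = 0.
Proof. by rewrite -(scale0r 0) dotZr mul0r. Qed.

Lemma dotNr u w : dot u (- w) = - dot u w.
Proof. by rewrite -scaleN1r dotZr mulN1r. Qed.

Lemma dotBr u w p : dot u (w - p) = dot u w - dot u p.
Proof. by rewrite dotDr dotNr. Qed.

Lemma dot_sumr (I : Type) (r : seq I) (P : pred I) u (F : I -> 'cV[R]_d) :
  dot u (\sum_(i <- r | P i) F i) = \sum_(i <- r | P i) dot u (F i).
Proof. by elim/big_rec2: _ => [|i a b _ <-]; rewrite ?dot0r ?dotDr. Qed.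

Lemma dotDl u w p : dot (u + w) p = dot u p + dot w p.
Proof. by rewrite !(dotC _ p) dotDr. Qed.

Lemma dotZl a u w : dot (a *: u) w = a * dot u w.
Proof. by rewrite dotC dotZr dotC. Qed.

Lemma dotNl u w : dot (- u) w = - dot u w.
Proof. by rewrite dotC dotNr dotC. Qed.

Lemma dotBl u w p : dot (u - w) p = dot u p - dot w p.
Proof. by rewrite dotDl dotNl. Qed.

Lemma dot_suml (I : Type) (r : seq I) (P : pred I) u (F : I -> 'cV[R]_d) :
  dot (\sum_(i <- r | P i) F i) u = \sum_(i <- r | P i) dot (F i) u.
Proof. by rewrite dotC dot_sumr; apply: eq_bigr => i _; rewrite dotC. Qed.

Lemma dot_ge0 u : 0 <= dot u u.
Proof. by apply: sumr_ge0 => i _; rewrite -expr2 sqr_ge0. Qed.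

Lemma dot_eq0 u : dot u u = 0 -> u = 0.
Proof.
move=> h; apply/matrixP => i j; rewrite ord1 mxE.
have /(_ i isT)/eqP := psumr_eq0P (fun i _ => sqr_ge0 (u i 0)) h.
by rewrite sqrf_eq0 => /eqP.
Qed.

Lemma dot_gt0 u : u != 0 -> 0 < dot u u.
Proof.
by move=> u0; rewrite lt_def dot_ge0 andbT; apply: contra_neq u0 => /dot_eq0.
Qed.

Lemma dot_delta m u : dot (delta_mx m 0) u = u m 0.
Proof.
rewrite /dot (bigD1 m) //= mxE !eqxx mul1r big1 ?addr0 // => i /negbTE im.
by rewrite mxE im mul0r.
Qed.

Lemma dot_outer p q u w : dot p ((u *m w^T) *m q) = dot p u * dot q w.
Proof.
have e : w^T *m q = (dot q w)%:M.
  apply/matrixP => i j; rewrite !ord1 !mxE eqxx mulr1n.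
  by apply: eq_bigr => k _; rewrite mxE mulrC.
by rewrite -mulmxA e mul_mx_scalar dotZr mulrC.
Qed.

Lemma dot_mx_delta (A : 'M[R]_d) i j : dot (delta_mx i 0) (A *m delta_mx j 0) = A i j.
Proof.
rewrite dot_delta mxE (bigD1 j) //= mxE !eqxx mulr1 big1 ?addr0 // => k /negbTE kj.
by rewrite mxE kj mulr0.
Qed.

End Dot.

(* Induction on the size by the Schur complement. *)
Lemma posdef_det_gt0 (R : realType) n (G : 'M[R]_n) :
    G^T = G -> (forall c : 'cV_n, c != 0 -> 0 < (c^T *m G *m c) 0 0) ->
  0 < \det G.
Proof.
elim: n G => [|n IH] G; first by rewrite det_mx00.
move: G; rewrite -[n.+1]/(1 + n)%N => G symG posG.
set a := G 0 0.
have Ga : ulsubmx G = a%:M.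
  by apply/matrixP => i j; rewrite !ord1 !mxE eqxx mulr1n; congr (G _ _); exact: val_inj.
have a0 : 0 < a.
  have /posG : (delta_mx 0 0 : 'cV[R]_(1 + n)) != 0.
    by apply/eqP => /matrixP/(_ 0 0)/eqP; rewrite !mxE !eqxx oner_eq0.
  by rewrite trmx_delta -rowE -colE !mxE.
set r := ursubmx G; set S := drsubmx G.
have Gr : dlsubmx G = r^T by rewrite /r trmx_ursub symG.
have Gb : G = block_mx a%:M r r^T S by rewrite -Ga -Gr submxK.
pose U : 'M[R]_(1 + n) := block_mx 1%:M (- a^-1 *: r) 0 1%:M.
pose S' := S - a^-1 *: (r^T *m r).
have an0 : a != 0 by rewrite gt_eqF.
have GU : U^T *m G *m U = block_mx a%:M 0 0 S'.
  have trZ : (- a^-1 *: r)^T = - (a^-1 *: r^T) by rewrite linearZ /= scaleNr.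
  rewrite Gb /U tr_block_mx !trmx1 trmx0 !mulmx_block.
  rewrite !mul1mx !mul0mx !mulmx0 !mulmx1 !addr0 !mul_scalar_mx.
  rewrite trZ scaleNr !mulNmx !mulmxN -!scalemxAl -!scalemxAr !mul_mx_scalar.
  rewrite scalerN !scalerA mulVf // mulfV // !scale1r !addNr.
  by rewrite mul0mx scaler0 oppr0 add0r addrC.
have detU : \det U = 1 by rewrite det_ublock !det1 mulr1.
have -> : \det G = a * \det S'.
  have := congr1 determinant GU.
  by rewrite !det_mulmx det_tr detU mul1r mulr1 => ->; rewrite det_ublock det_scalar1.
apply: mulr_gt0 => //; apply: IH => [|c c0].
  rewrite /S' linearB linearZ /= trmx_mul trmxK; congr (_ - _).
  by rewrite /S trmx_drsub symG.
(* The form of [S'] at c is the form of [G] at U (0, c), which is nonzero as its lower part is c. *)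
pose c1 : 'cV[R]_(1 + n) := col_mx 0 c.
have Uc : U *m c1 != 0.
  apply: contra_neq c0 => /(congr1 dsubmx); rewrite mul_block_col col_mxKd.
  by rewrite mul0mx add0r mul1mx => ->; apply/matrixP => i j; rewrite !mxE.
have e : (U *m c1)^T *m G *m (U *m c1) = c1^T *m (U^T *m G *m U) *m c1.
  by rewrite trmx_mul !mulmxA.
have := posG _ Uc; rewrite e GU.
by rewrite tr_col_mx mul_row_block !mul_row_col trmx0 !mul0mx !mulmx0 !add0r.
Qed.

(** * Integrals of products of two affine functions over a simplex *)

Section SimplexIntegral.
Context {R : realType}.

Lemma Rintegral_deriv_horner (p : {poly R}) (a b : R) : a <= b ->
  \int[lebesgue_measure]_(t in `[a, b]%classic) (p^`()).[t] = p.[b] - p.[a].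
Proof.
rewrite le_eqVlt => /predU1P[->|ab]; first by rewrite set_itv1 Rintegral_set1 subrr.
rewrite /Rintegral (@continuous_FTC2 _ _ (horner p)) // ?derivE.
- by apply: continuous_subspaceT => x; rewrite -derivE; exact: continuous_horner.
- split.
  + by move=> x _; exact: derivable_horner.
  + by apply: cvg_at_right_filter; exact: continuous_horner.
  + by apply: cvg_at_left_filter; exact: continuous_horner.
- by [].
Qed.

(** The shape of the integrals over slices: a slice at t has size s - t, and the integral over it is
    (s - t)^n times a quadratic polynomial in s - t. *)
Lemma Rintegral_pow_quadratic n (s x y z : R) : 0 <= s ->
  \int[lebesgue_measure]_(t in `[0%R, s]%classic)
     ((s - t) ^+ n * (x + (s - t) * y + (s - t) ^+ 2 * z)) =
  s ^+ n.+1 / n.+1%:R * x + s ^+ n.+2 / n.+2%:R * y + s ^+ n.+3 / n.+3%:R * z.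
Proof.
move=> s0.
have [X dX hX] : exists2 X : {poly R}, X^`() = - 1 & forall t, X.[t] = s - t.
  by exists (s%:P - 'X) => [|t]; rewrite ?derivB ?derivC ?derivX ?sub0r ?hornerE.
(* An antiderivative in powers of s - t; the leading sign makes up for the derivative -1 of s -
   t. *)
pose p := - ((x / n.+1%:R) *: X ^+ n.+1 + (y / n.+2%:R) *: X ^+ n.+2
             + (z / n.+3%:R) *: X ^+ n.+3).
have n0 k : k.+1%:R != 0 :> R by rewrite pnatr_eq0.
have dXn k : (X ^+ k.+1)^`() = (- k.+1%:R) *: X ^+ k.
  by rewrite deriv_exp dX mulN1r scaleNr scaler_nat mulNrn.
transitivity (\int[lebesgue_measure]_(t in `[0, s]%classic) (p^`()).[t]).
  apply: eq_Rintegral => t _.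
  rewrite /p derivN !derivD !derivZ !dXn !(hornerN, hornerD, hornerZ, horner_exp) hX.
  rewrite (exprS _ n.+1) (exprS _ n).
  move: (n0 n) (n0 n.+1) (n0 n.+2) ((s - t) ^+ n).
  move: (n.+1%:R) (n.+2%:R) (n.+3%:R) => a b c a0 b0 c0 S.
  by field; rewrite a0 b0 c0.
rewrite Rintegral_deriv_horner // /p !(hornerN, hornerD, hornerZ, horner_exp) !hX.
rewrite subrr !expr0n /= subr0.
by ring.
Qed.

(* The value at the k-th vertex of [{t | t_i >= 0, sum t_i <= s}] of the
   affine function [a 0 + sum_i t_i * a i.+1]. *)
Definition scaled_vertex_value (s : R) (a : nat -> R) (k : nat) : R :=
  a 0%N + (if k is 0%N then 0 else s * a k).

(** By induction on the dimension: the slice at first coordinate t is a simplex of size s - t, on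
    which both factors are again affine. The product form of [f] is assumed on the simplex only,
    because test functions extended by 0 are affine only there. *)
Lemma simplex_integral_affine_mul l (s : R) (f : seq R -> R) (a b : nat -> R) :
  0 <= s ->
  (forall t, size t = l -> (forall k, 0 <= t`_k) -> \sum_(k < l) t`_k <= s ->
     f t = (a 0%N + \sum_(k < l) t`_k * a k.+1) * (b 0%N + \sum_(k < l) t`_k * b k.+1)) ->
  let va := scaled_vertex_value s a in let vb := scaled_vertex_value s b in
  simplex_integral l s f =
  s ^+ l / (l.+2)`!%:R *
  (\sum_(k < l.+1) va k * vb k + (\sum_(k < l.+1) va k) * (\sum_(k < l.+1) vb k)).
Proof.
elim: l s f a b => [|l IH] s f a b s0 hf /=.
  rewrite hf //; first last.
  - by rewrite big_ord0.
  - by move=> k; rewrite nth_nil.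
  by rewrite !big_ord0 !big_ord1 /scaled_vertex_value !addr0 expr0 !factS fact0 !muln1; field.
(* [B a] is the value at the vertex whose first coordinate is s, and [B a + (s - t) * A a k] the
   value at the k-th vertex of the slice at t. *)
pose A (a : nat -> R) k := (if k is 0%N then 0 else a k.+1) - a 1%N.
pose B (a : nat -> R) := a 0%N + s * a 1%N.
have split_sum (G : R -> R -> R) :
    \sum_(k < l.+2) G (scaled_vertex_value s a k) (scaled_vertex_value s b k) =
    G (B a) (B b) + \sum_(k < l.+1) G (B a + s * A a k) (B b + s * A b k).
  rewrite 2!big_ord_recl [in RHS]big_ord_recl /= addrCA; congr (_ + (_ + _)).
    by rewrite /scaled_vertex_value /B /A; congr G; ring.
  by apply: eq_bigr => k _; rewrite /scaled_vertex_value /B /A /=; congr G; ring.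
pose SA := \sum_(k < l.+1) A a k; pose SB := \sum_(k < l.+1) A b k.
pose SAB := \sum_(k < l.+1) A a k * A b k.
have sum1 u (c : nat -> R) : \sum_(k < l.+1) (B c + u * A c k) =
    l.+1%:R * B c + u * \sum_(k < l.+1) A c k.
  by rewrite big_split /= sumr_const card_ord -[B c *+ _]mulr_natl -mulr_sumr.
have sum2 u : \sum_(k < l.+1) (B a + u * A a k) * (B b + u * A b k) =
    l.+1%:R * (B a * B b) + u * (B a * SB + B b * SA) + u ^+ 2 * SAB.
  have -> : l.+1%:R * (B a * B b) = \sum_(k < l.+1) (B a * B b).
    by rewrite sumr_const card_ord mulr_natl.
  rewrite /SA /SB /SAB 2!mulr_sumr -big_split !mulr_sumr -!big_split /=.
  by apply: eq_bigr => k _; ring.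
pose N : R := l%:R; pose Fl : R := (l.+2)`!%:R.
have eq_int t : t \in `[0%R, s]%classic ->
    simplex_integral l (s - t) (fun u => f (t :: u)) =
    (s - t) ^+ l * ((N + 1) * (N + 2) / Fl * (B a * B b)
      + (s - t) * ((N + 2) / Fl * (B a * SB + B b * SA))
      + (s - t) ^+ 2 * ((SAB + SA * SB) / Fl)).
  rewrite inE /= in_itv /= => /andP[t0 ts].
  (* Coefficients of the restriction to the slice: the constant term absorbs the first
     coordinate. *)
  pose sh (c : nat -> R) k := if k is 0%N then c 0%N + t * c 1%N else c k.+1.
  rewrite (IH _ _ (sh a) (sh b)) ?subr_ge0 //; last first.
    move=> u su u0 us; rewrite hf /=; first last.
    - by rewrite big_ord_recl /=; lra.
    - by case.
    - by rewrite su.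
    by rewrite !big_ord_recl /= !addrA.
  have vsh c k : scaled_vertex_value (s - t) (sh c) k = B c + (s - t) * A c k.
    by case: k => [|k]; rewrite /scaled_vertex_value /sh /B /A; ring.
  have sumv c : \sum_(k < l.+1) scaled_vertex_value (s - t) (sh c) k =
      l.+1%:R * B c + (s - t) * \sum_(k < l.+1) A c k.
    by rewrite -sum1; apply: eq_bigr => k _; rewrite vsh.
  have sumv2 : \sum_(k < l.+1) scaled_vertex_value (s - t) (sh a) k *
        scaled_vertex_value (s - t) (sh b) k =
      l.+1%:R * (B a * B b) + (s - t) * (B a * SB + B b * SA) + (s - t) ^+ 2 * SAB.
    by rewrite -sum2; apply: eq_bigr => k _; rewrite !vsh.
  rewrite sumv2 !sumv -/SA -/SB -/Fl -[l.+1]addn1 natrD -/N.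
  have F0 : Fl != 0 by rewrite pnatr_eq0 -lt0n fact_gt0.
  by field.
under eq_Rintegral => t ht do rewrite eq_int //.
rewrite Rintegral_pow_quadratic // (split_sum (fun x y => x * y)).
rewrite (split_sum (fun x _ => x)) (split_sum (fun _ y => y)) sum2 !sum1 -/SA -/SB.
rewrite [(l.+3)`!]factS natrM -/Fl.
have F0 : Fl != 0 by rewrite pnatr_eq0 -lt0n fact_gt0.
have n0 k : k.+1%:R != 0 :> R by rewrite pnatr_eq0.
have N1 : l.+1%:R = N + 1 by rewrite -natr1.
have N2 : l.+2%:R = N + 2 by rewrite -natr1 N1; ring.
have N3 : l.+3%:R = N + 3 by rewrite -natr1 N2; ring.
have := (n0 l, n0 l.+1, n0 l.+2) => -[[h1 h2] h3].
rewrite N1 in h1 *; rewrite N2 in h2 *; rewrite N3 in h3 *.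
rewrite !exprS; by field; apply/and4P; split.
Qed.

End SimplexIntegral.

(** * Polynomials of degree at most one as affine functions *)

Section AffineFunctions.
Context {R : realType} {d : nat}.
Implicit Types (f : 'cV[R]_d -> R) (D : set 'cV[R]_d).

Definition affine_fun (c : R) (b : 'cV[R]_d) : 'cV[R]_d -> R := fun x => c + dot b x.

Definition affine_mpoly (c : R) (b : 'cV[R]_d) : mpoly d R :=
  mpolyC d c + \sum_i b i 0 *: mpolyX R (mnm1 i).

Lemma polyfun_affine c b : polyfun (affine_mpoly c b) = affine_fun c b.
Proof.
apply/funext => x; rewrite /polyfun /affine_mpoly /affine_fun mevalD mevalC; congr (_ + _).
rewrite raddf_sum; apply: eq_bigr => i _ /=.
by rewrite mevalZ mevalXU.
Qed.

Lemma linear_mpoly_homog b : affine_mpoly 0 b \is @ishomog1 d R 1 mdeg.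
Proof.
rewrite /affine_mpoly raddf0 add0r; apply: rpred_sum => i _.
by apply: rpredZ; rewrite dhomogX /= mdeg1.
Qed.

Lemma affine_msize c b : (mmeasure mdeg (affine_mpoly c b) <= 2)%N.
Proof.
apply: leq_trans (msizeD_le _ _) _; rewrite geq_max msizeC; apply/andP; split.
  by case: (c == 0).
apply: leq_trans (msize_sum _ _ _) _; apply/bigmax_leqP => i _.
by apply: leq_trans (msizeZ_le _ _) _; rewrite msizeX mdeg1.
Qed.

Lemma polyfun_sum_monomials (p : mpoly d R) (x : 'cV[R]_d) :
  polyfun p x = \sum_(m <- msupp p) mcoeff m p * meval (fun i => x i 0) (mpolyX R m).
Proof. by rewrite /polyfun mevalE; apply: eq_bigr => m _; rewrite mevalX. Qed.

(** A monomial of degree below 2 is 1 or a coordinate, so an induction over the support collects the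
    constant and the linear part. *)
Lemma Pk1P D f : Pk 1 D f <-> exists c b, f = patch (fun=> 0) D (affine_fun c b).
Proof.
split=> [[p hp ->]|[c [b ->]]]; last first.
  by exists (affine_mpoly c b); rewrite ?polyfun_affine //; exact: affine_msize.
suff [c [b pE]] : exists c b, forall x, polyfun p x = affine_fun c b x.
  by exists c, b; congr patch; apply/funext.
suff [c [b pE]] : exists c b, forall x : 'cV[R]_d,
    \sum_(m <- msupp p) mcoeff m p * meval (fun i => x i 0) (mpolyX R m) = affine_fun c b x.
  by exists c, b => x; rewrite polyfun_sum_monomials pE.
have : {subset msupp p <= [pred m | (mdeg m < 2)%N]}.
  by move=> m /msize_mdeg_lt hm; exact: leq_trans hm hp.
elim: (msupp p) => [|m s IH] hs.
  by exists 0, 0 => x; rewrite big_nil /affine_fun dotC dot0r addr0.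
have [|c [b e]] := IH; first by move=> k ks; apply: hs; rewrite inE ks orbT.
have := hs m (mem_head _ _); rewrite inE ltnS leq_eqVlt ltnS leqn0 => /orP[].
  move=> /mdeg1P[i /eqP->]; exists c, (b + mcoeff (mnm1 i) p *: delta_mx i 0) => x.
  by rewrite big_cons e mevalXU /affine_fun dotDl dotZl dot_delta; ring.
rewrite mdeg_eq0 => /eqP->; exists (c + mcoeff mnm0 p), b => x.
rewrite big_cons e mevalX /affine_fun big1 => [|i _]; first by ring.
by rewrite mnm0E expr0.
Qed.

Lemma Pk1_setTP f : Pk 1 setT f <-> exists c b, f = affine_fun c b.
Proof.
rewrite Pk1P; split=> -[c [b ->]]; exists c, b; first by rewrite patch_setT.
by rewrite patch_setT.
Qed.

Lemma Hk1_setTP f : Hk 1 setT f <-> exists b, f = dot b.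
Proof.
split=> [[p /dhomogP hp ->]|[b ->]]; last first.
  exists (affine_mpoly 0 b); first exact: linear_mpoly_homog.
  by rewrite patch_setT polyfun_affine; apply/funext => x; rewrite /affine_fun add0r.
rewrite patch_setT.
suff [b pE] : exists b, forall x : 'cV[R]_d,
    \sum_(m <- msupp p) mcoeff m p * meval (fun i => x i 0) (mpolyX R m) = dot b x.
  by exists b; apply/funext => x; rewrite polyfun_sum_monomials pE.
have : {subset msupp p <= [pred m | mdeg m == 1%N]}.
  by move=> m /hp /= hm; rewrite inE; apply/eqP.
elim: (msupp p) => [|m s IH] hs.
  by exists 0 => x; rewrite big_nil dotC dot0r.
have [|b e] := IH; first by move=> k ks; apply: hs; rewrite inE ks orbT.
have := hs m (mem_head _ _); rewrite inE => /mdeg1P[i /eqP->].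
exists (b + mcoeff (mnm1 i) p *: delta_mx i 0) => x.
by rewrite big_cons e mevalXU dotDl dotZl dot_delta; ring.
Qed.

End AffineFunctions.

(** * Barycentric coordinates of the simplex *)

Section Barycentric.
Context {R : realType} {d : nat} (v : 'I_d.+1 -> 'cV[R]_d).

(** Column i is [v i] below a 1, so that the solution of the linear system with right-hand side (1,
    x) is the vector of barycentric coordinates of x. *)
Definition vertex_mx : 'M[R]_(1 + d) :=
  \matrix_(j, i) (col_mx (const_mx 1) (v i) : 'cV_(1 + d)) j 0.

Definition bary (i : 'I_d.+1) (x : 'cV[R]_d) : R :=
  (invmx vertex_mx *m col_mx (const_mx 1) x) i 0.

Definition bary_grad (i : 'I_d.+1) : 'cV[R]_d :=
  \col_m invmx vertex_mx i (rshift 1 m).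

Lemma baryE i x : bary i x = bary i 0 + dot (bary_grad i) x.
Proof.
rewrite /bary mxE [X in _ = X + _]mxE !big_split_ord /= !big_ord1 !col_mxEu !mxE -addrA.
congr (_ + _); rewrite [X in _ = X + _]big1 ?add0r => [|m _].
  by apply: eq_bigr => m _; rewrite col_mxEd mxE.
by rewrite col_mxEd mxE mulr0.
Qed.

Lemma vertex_mx_mul (c : 'cV[R]_(1 + d)) :
  vertex_mx *m c = col_mx (const_mx (\sum_i c i 0)) (\sum_i c i 0 *: v i).
Proof.
apply/matrixP => j k; rewrite ord1 mxE.
case: (split_ordP j) => [j' ->|j' ->].
  rewrite col_mxEu mxE; apply: eq_bigr => i _.
  by rewrite mxE col_mxEu mxE mul1r.
rewrite col_mxEd summxE; apply: eq_bigr => i _.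
by rewrite [in RHS]mxE mxE col_mxEd mulrC.
Qed.

Hypothesis hv : affinely_independent v.

(** A kernel vector is an affine dependence between the vertices. *)
Lemma vertex_mx_unit : vertex_mx \in unitmx.
Proof.
rewrite -unitmx_tr -row_free_unit -kermx_eq0; apply/rowV0P => u /sub_kermxP hu.
have : vertex_mx *m u^T = 0 by rewrite -[vertex_mx]trmxK -trmx_mul hu trmx0.
rewrite vertex_mx_mul => /eqP; rewrite col_mx_eq0 => /andP[/eqP h1 /eqP h2].
have {}h1 : \sum_i u^T i 0 = 0 by have /matrixP/(_ 0 0) := h1; rewrite !mxE.
by apply/rowP => i; have := hv h1 h2 i; rewrite !mxE.
Qed.

Lemma bary_mx x : \col_i bary i x = invmx vertex_mx *m col_mx (const_mx 1) x.
Proof. by apply/matrixP => i j; rewrite ord1 mxE. Qed.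

Lemma sum_bary_combo x : \sum_i bary i x = 1 /\ \sum_i bary i x *: v i = x.
Proof.
have := vertex_mx_mul (\col_i bary i x).
rewrite {1}bary_mx mulKVmx ?vertex_mx_unit // => /eq_col_mx[/matrixP/(_ 0 0) h1 h2].
split.
  by move: h1; rewrite !mxE => ->; apply: eq_bigr => i _; rewrite mxE.
by rewrite {2}h2; apply: eq_bigr => i _; rewrite mxE.
Qed.

Lemma sum_bary x : \sum_i bary i x = 1.
Proof. by have [] := sum_bary_combo x. Qed.

Lemma bary_combo x : \sum_i bary i x *: v i = x.
Proof. by have [] := sum_bary_combo x. Qed.

(** The difference of two barycentric representations of [v j] is an affine dependence. *)
Lemma bary_vertex i j : bary i (v j) = (i == j)%:R.
Proof.
pose c k := bary k (v j) - (k == j)%:R.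
apply/eqP; rewrite -subr_eq0; apply/eqP; apply: (hv (c := c)).
  rewrite sumrB sum_bary (bigD1 j) //= eqxx big1 ?addr0 ?subrr // => k /negbTE->.
  by [].
under eq_bigr => k _ do rewrite scalerBl.
rewrite sumrB bary_combo (bigD1 j) //= eqxx scale1r big1 ?addr0 ?subrr // => k /negbTE->.
by rewrite scale0r.
Qed.

Lemma grad_vertex i j k : dot (bary_grad i) (v j - v k) = (i == j)%:R - (i == k)%:R.
Proof. by rewrite dotBr -!bary_vertex !(baryE i (v _)); ring. Qed.

Lemma sum_grad u : \sum_i dot (bary_grad i) u = 0.
Proof.
have := sum_bary u; have := sum_bary 0.
under [in X in _ -> X -> _]eq_bigr => i _ do rewrite baryE.
by rewrite big_split /= => ->; lra.
Qed.

Lemma grad_combo u : \sum_i dot (bary_grad i) u *: v i = u.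
Proof.
have := bary_combo u; have := bary_combo 0.
under [in X in _ -> X -> _]eq_bigr => i _ do rewrite baryE scalerDl.
by rewrite big_split /= => ->; rewrite add0r.
Qed.

(** The gradients sum to zero, so x drops out: a constant vector is a combination of the v_i - x
    with constant coefficients. *)
Lemma grad_edges u x : \sum_i dot (bary_grad i) u *: (v i - x) = u.
Proof.
under eq_bigr => i _ do rewrite scalerBr.
by rewrite sumrB grad_combo -scaler_suml sum_grad scale0r subr0.
Qed.

(** Used at y = x, for the relation between the v_i - x, and at y = 0, to write x with constant
    coefficients. *)
Lemma bary_edges x y : \sum_i bary i y *: (v i - x) = y - x.
Proof.
under eq_bigr => i _ do rewrite scalerBr.
by rewrite sumrB bary_combo -scaler_suml sum_bary scale1r.
Qed.

Lemma affine_fun_bary c b x :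
  affine_fun c b x = \sum_i affine_fun c b (v i) * bary i x.
Proof.
under eq_bigr => i _ do rewrite /affine_fun mulrDl.
rewrite big_split -mulr_sumr sum_bary mulr1 /= /affine_fun; congr (_ + _).
rewrite -{1}(bary_combo x) dot_sumr; apply: eq_bigr => i _.
by rewrite dotZr mulrC.
Qed.

Lemma bary_affine_combo (A : {set 'I_d.+1}) (c : 'I_d.+1 -> R) i :
  \sum_(j in A) c j = 1 ->
  bary i (\sum_(j in A) c j *: v j) = if i \in A then c i else 0.
Proof.
move=> c1; rewrite baryE dot_sumr -[bary i 0]mulr1 -c1 mulr_sumr -big_split /=.
transitivity (\sum_(j in A) c j * (i == j)%:R).
  by apply: eq_bigr => j _; rewrite -bary_vertex dotZr (baryE i (v j)); ring.
have [iA|iA] := boolP (i \in A).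
  rewrite (bigD1 i) //= eqxx mulr1 big1 ?addr0 // => j /andP[_].
  by rewrite eq_sym => /negbTE->; rewrite mulr0.
rewrite big1 // => j jA; case: eqP => [ij|_]; last by rewrite mulr0.
by rewrite ij jA in iA.
Qed.

Lemma bary_hull0 (A : {set 'I_d.+1}) i x : hull v A x -> i \notin A -> bary i x = 0.
Proof. by move=> [c [_ c1 ->]] /negbTE iA; rewrite bary_affine_combo // iA. Qed.

Lemma hull_vertex (A : {set 'I_d.+1}) i : i \in A -> hull v A (v i).
Proof.
move=> iA; exists (fun j => (i == j)%:R); split.
- by move=> j _; exact: ler0n.
- rewrite (bigD1 i) //= eqxx big1 ?addr0 // => j /andP[_].
  by rewrite eq_sym => /negbTE->.
- rewrite (bigD1 i) //= eqxx scale1r big1 ?addr0 // => j /andP[_].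
  by rewrite eq_sym => /negbTE->; rewrite scale0r.
Qed.

(** The coordinates of the vertices in [A], cut off outside the face, form a basis: evaluation at
    the vertices shows freeness, and the remaining coordinates vanish on the face. *)
Lemma Pk1_hull_basis (A : {set 'I_d.+1}) : has_dim (Pk 1 (hull v A)) #|A|.
Proof.
have val_sum (c : 'I_d.+1 -> R) x : (\sum_(i in A) c i *: patch (fun=> 0) (hull v A) (bary i)) x
    = patch (fun=> 0) (hull v A) (fun x => \sum_(i in A) c i * bary i x) x.
  rewrite fct_sumE; under eq_bigr => i _ do rewrite -[(_ *: _) x]/(c i * patch _ _ _ x).
  rewrite /patch; case: ifP => // _.
  by rewrite big1 // => i _; rewrite mulr0.
apply: (has_dim_family (e := fun i => patch (fun=> 0) (hull v A) (bary i))).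
  move=> c /(congr1 (fun f => f (v _))) h i iA.
  have := h i; rewrite val_sum patchT ?inE; last exact: hull_vertex.
  rewrite (bigD1 i) //= bary_vertex eqxx mulr1 big1 ?addr0 // => j /andP[_ /negbTE ji].
  by rewrite bary_vertex ji mulr0.
move=> f; rewrite Pk1P; split=> [[c [b ->]]|[c ->]].
  exists (fun i => affine_fun c b (v i)); apply/funext => x.
  rewrite val_sum /patch; case: ifPn => //; rewrite inE => hx.
  rewrite affine_fun_bary (bigID (mem A)) /= [X in _ + X]big1 ?addr0 // => i iA.
  by rewrite (bary_hull0 hx iA) mulr0.
exists (\sum_(i in A) c i * bary i 0), (\sum_(i in A) c i *: bary_grad i).
apply/funext => x; rewrite val_sum /patch; case: ifP => // _.
rewrite /affine_fun dot_suml -big_split; apply: eq_bigr => i _ /=.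
by rewrite dotZl [in LHS]baryE; ring.
Qed.

End Barycentric.

(** * The inner product of affine functions on a face *)

Section InnerProduct.
Context {R : realType} {d : nat} (v : 'I_d.+1 -> 'cV[R]_d).

(** Only convex combinations are tested, so that functions extended by 0 outside the face
    qualify. *)
Definition affine_on (A : {set 'I_d.+1}) (f : 'cV[R]_d -> R) : Prop :=
  forall c : 'I_d.+1 -> R,
    (forall i, i \in A -> 0 <= c i) -> \sum_(i in A) c i = 1 ->
    f (\sum_(i in A) c i *: v i) = \sum_(i in A) c i * f (v i).

(** Passes from sums over a face to the enumeration of its vertices behind [vertex] and [param]. *)
Lemma sum_vertices (V : nmodType) (A : {set 'I_d.+1}) l (F : nat -> 'I_d.+1 -> V) :
  #|A| = l.+1 ->
  \sum_(i in A) F (index i (enum A)) i = \sum_(k < l.+1) F k (nth ord0 (enum A) k).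
Proof.
move=> cA; rewrite -big_enum (big_nth ord0) big_mkord -cardE cA.
by apply: eq_bigr => k _; rewrite index_uniq ?enum_uniq // -cardE cA.
Qed.

Lemma affine_on_param (A : {set 'I_d.+1}) l f t : #|A| = l.+1 -> affine_on A f ->
    (forall k, 0 <= t`_k) -> \sum_(k < l) t`_k <= 1 ->
  f (param v A l t) =
  f (vertex v A 0) + \sum_(k < l) t`_k * (f (vertex v A k.+1) - f (vertex v A 0)).
Proof.
move=> cA fA t0 t1.
(* Barycentric weights of [param v A l t]: vertex 0 receives what the t_k leave of 1. *)
pose C k := if k is k'.+1 then t`_k' else 1 - \sum_(k < l) t`_k.
have C0 k : 0 <= C k by case: k => [|k] //=; rewrite subr_ge0.
have e (V : lmodType R) (F : nat -> V) : F 0%N + \sum_(k < l) t`_k *: (F k.+1 - F 0%N) =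
    \sum_(k < l.+1) C k *: F k.
  rewrite big_ord_recl /= scalerBl scale1r -addrA; congr (_ + _).
  under eq_bigr => k _ do rewrite scalerBr.
  by rewrite sumrB addrC scaler_suml.
rewrite /param (e _ (vertex v A)) [RHS](e R^o (f \o vertex v A)) /=.
have := fA (fun i => C (index i (enum A))) (fun i _ => C0 _).
rewrite (sum_vertices (fun k _ => C k) cA) (sum_vertices (fun k i => C k *: v i) cA).
rewrite (sum_vertices (fun k i => C k * f (v i)) cA); apply.
by rewrite big_ord_recl /= subrK.
Qed.

Lemma L2_affine l (A : subsimplex d l) f g : affine_on (val A) f -> affine_on (val A) g ->
  L2 v A f g = Num.sqrt (\det (gram v (val A) l)) / (l.+2)`!%:R *
    (\sum_(i in val A) f (v i) * g (v i) +
     (\sum_(i in val A) f (v i)) * (\sum_(i in val A) g (v i))).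
Proof.
have cA : #|val A| = l.+1 by apply/eqP; exact: valP A.
move=> fA gA; rewrite /L2 -mulrA; congr (_ * _).
pose c h k : R := if k is k'.+1 then h (vertex v (val A) k) - h (vertex v (val A) 0)
                  else h (vertex v (val A) 0).
rewrite (simplex_integral_affine_mul (a := c f) (b := c g)) //; last first.
  by move=> t _ t0 t1; rewrite !affine_on_param.
have vE h k : scaled_vertex_value 1 (c h) k = h (vertex v (val A) k).
  case: k => [|k]; rewrite /scaled_vertex_value /c; first by rewrite addr0.
  by rewrite mul1r addrC subrK.
have sE h : \sum_(k < l.+1) scaled_vertex_value 1 (c h) k = \sum_(i in val A) h (v i).
  by rewrite (sum_vertices (fun _ i => h (v i)) cA); apply: eq_bigr => k _; rewrite vE.
rewrite !sE (sum_vertices (fun _ i => f (v i) * g (v i)) cA).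
under eq_bigr => k _ do rewrite !vE.
by rewrite expr1n mul1r.
Qed.

Hypothesis hv : affinely_independent v.

Lemma edges_free (A : {set 'I_d.+1}) l (c : 'I_l -> R) : #|A| = l.+1 ->
  \sum_k c k *: edge v A k = 0 -> forall k, c k = 0.
Proof.
move=> cA h k0.
(* All edges start at vertex 0, so a dependence between them becomes an affine dependence with minus
   the total at vertex 0. The default of [insub] is not met on [A], where indices are at most l. *)
pose C k := if k is k'.+1 then (if insub k' is Some i then c i else 0) else - \sum_k c k.
have CS (k : 'I_l) : C k.+1 = c k by rewrite /C valK.
pose c' i := if i \in A then C (index i (enum A)) else 0.
have sum_c' (V : lmodType R) (F : 'I_d.+1 -> V) : \sum_i c' i *: F i =
    \sum_(k < l) c k *: F (nth ord0 (enum A) k.+1) - (\sum_k c k) *: F (nth ord0 (enum A) 0).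
  rewrite (bigID (mem A)) /= [X in _ + X]big1 ?addr0; last first.
    by move=> i /negbTE iA; rewrite /c' iA scale0r.
  transitivity (\sum_(i in A) C (index i (enum A)) *: F i).
    by apply: eq_bigr => i iA; rewrite /c' iA.
  rewrite (sum_vertices (fun k i => C k *: F i) cA) big_ord_recl addrC /= scaleNr.
  by congr (_ - _); apply: eq_bigr => k _; exact: (congr1 (fun z => z *: _) (CS k)).
have kA : (k0.+1 < size (enum A))%N by rewrite -cardE cA ltnS.
have : c' (nth ord0 (enum A) k0.+1) = 0.
  apply: hv.
    have := sum_c' R^o (fun=> 1); rewrite /GRing.scale /=.
    under eq_bigr => i _ do rewrite mulr1.
    by under [in X in _ = X -> _]eq_bigr => i _ do rewrite mulr1; rewrite mulr1 subrr.
  rewrite sum_c' -[RHS]h /edge /vertex.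
  under [in RHS]eq_bigr => k _ do rewrite scalerBr.
  by rewrite sumrB scaler_suml.
by rewrite /c' -mem_enum mem_nth // index_uniq ?enum_uniq // CS.
Qed.

(** The quadratic form of the Gram matrix is the squared length of a combination of edges. Hence the
    volume factor in [L2] is nonzero. *)
Lemma gram_det_gt0 (A : {set 'I_d.+1}) l : #|A| = l.+1 -> 0 < \det (gram v A l).
Proof.
move=> cA; apply: posdef_det_gt0 => [|c c0].
  by apply/matrixP => i j; rewrite !mxE dotC.
have -> : (c^T *m gram v A l *m c) 0 0 =
    dot (\sum_k c k 0 *: edge v A k) (\sum_k c k 0 *: edge v A k).
  rewrite mxE dot_sumr; apply: eq_bigr => k _.
  rewrite mxE dotZr dot_suml mulrC; congr (_ * _); apply: eq_bigr => j _.
  by rewrite dotZl !mxE.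
apply: dot_gt0; apply: contra_neq c0 => /(edges_free cA) h.
by apply/matrixP => i j; rewrite ord1 h mxE.
Qed.

Lemma Pk1_affine_on (A : {set 'I_d.+1}) f : Pk 1 (hull v A) f -> affine_on A f.
Proof.
move=> /Pk1P[c [b ->]] w w0 w1; rewrite patchT; last by rewrite inE; exists w.
transitivity (\sum_(i in A) w i * affine_fun c b (v i)).
  under [RHS]eq_bigr => i _ do rewrite mulrDr -dotZr.
  by rewrite big_split -mulr_suml w1 mul1r -dot_sumr.
by apply: eq_bigr => i iA; rewrite patchT // inE; exact: hull_vertex.
Qed.

(** Linearity extends the vanishing to the test function with the same vertex values as [f]; the
    formula for the inner product then reads sum f^2 + (sum f)^2 = 0. *)
Lemma L2_affine_eq0 l (A : subsimplex d l) f m (b : 'I_m -> 'cV[R]_d -> R) :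
    affine_on (val A) f -> is_basis (Pk 1 (hull v (val A))) b ->
    (forall i, L2 v A f (b i) = 0) ->
  forall i, i \in val A -> f (v i) = 0.
Proof.
move=> fA [free span] h.
have cA : #|val A| = l.+1 by apply/eqP; exact: valP A.
set C := Num.sqrt (\det (gram v (val A) l)) / (l.+2)`!%:R.
have C0 : C != 0.
  by rewrite mulf_neq0 ?invr_eq0 ?pnatr_eq0 -?lt0n ?fact_gt0 // gt_eqF // sqrtr_gt0 gram_det_gt0.
have bP i : Pk 1 (hull v (val A)) (b i).
  rewrite span; exists (fun j => (i == j)%:R); rewrite (bigD1 i) //= eqxx scale1r.
  by rewrite big1 ?addr0 // => j; rewrite eq_sym => /negbTE->; rewrite scale0r.
(* The affine interpolant of the vertex values of [f], cut off outside the face so as to lie in the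
   test space. *)
pose q := patch (fun=> 0) (hull v (val A))
  (affine_fun (\sum_i f (v i) * bary v i 0) (\sum_i f (v i) *: bary_grad v i)).
have qv i : i \in val A -> q (v i) = f (v i).
  move=> iA; rewrite /q patchT ?inE; last exact: hull_vertex.
  rewrite /affine_fun dot_suml -big_split /= (bigD1 i) //= dotZl -mulrDr -baryE bary_vertex //.
  rewrite eqxx mulr1 big1 ?addr0 // => j /negbTE ji.
  by rewrite dotZl -mulrDr -baryE bary_vertex // ji mulr0.
have [c qE] : exists c : 'I_m -> R, q = \sum_i c i *: b i.
  have : Pk 1 (hull v (val A)) q by apply/Pk1P; do 2 eexists.
  by rewrite span.
have qE' x : q x = \sum_j c j * b j x by rewrite qE fct_sumE.
have L2b j : \sum_(i in val A) f (v i) * b j (v i) +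
    (\sum_(i in val A) f (v i)) * (\sum_(i in val A) b j (v i)) = 0.
  have := h j; rewrite L2_affine //; last exact: Pk1_affine_on.
  by move=> /eqP; rewrite mulf_eq0 (negbTE C0) => /eqP.
have : \sum_(i in val A) f (v i) * q (v i) +
    (\sum_(i in val A) f (v i)) * (\sum_(i in val A) q (v i)) = 0.
  under eq_bigr => i _ do rewrite qE' mulr_sumr.
  under [in X in _ + _ * X]eq_bigr => i _ do rewrite qE'.
  rewrite exchange_big [in X in _ + _ * X]exchange_big /= mulr_sumr -big_split /=.
  rewrite big1 // => j _.
  transitivity (c j * (\sum_(i in val A) f (v i) * b j (v i) +
      (\sum_(i in val A) f (v i)) * (\sum_(i in val A) b j (v i)))); last by rewrite L2b mulr0.
  rewrite [RHS]mulrDr; congr (_ + _).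
    by rewrite [RHS]mulr_sumr; apply: eq_bigr => i _; ring.
  by rewrite -[X in _ * X]mulr_sumr; ring.
under eq_bigr => i iA do rewrite qv // -expr2.
under [in X in _ + _ * X]eq_bigr => i iA do rewrite qv //.
rewrite -expr2 => /eqP; rewrite paddr_eq0 ?sqr_ge0 //; last first.
  by apply: sumr_ge0 => i _; exact: sqr_ge0.
move=> /andP[/eqP s0 _] i iA.
have /(_ i iA)/eqP := psumr_eq0P (fun i _ => sqr_ge0 (f (v i))) s0.
by rewrite sqrf_eq0 => /eqP.
Qed.

End InnerProduct.

(** * The fields sum_ij B_ij (v_i - x)(v_j - x)^T and their derivatives *)

Section BarycentricFields.
Context {R : realType} {d : nat} (v : 'I_d.+1 -> 'cV[R]_d).
Implicit Types (b : 'I_d.+1 -> 'I_d.+1 -> 'I_d.+1 -> R) (x u p q n : 'cV[R]_d).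

Definition coef b i j x : R := \sum_k b i j k * bary v k x.

Definition coef_grad b i j : 'cV[R]_d := \sum_k b i j k *: bary_grad v k.

Definition bary_field b x : 'M[R]_d :=
  \sum_i \sum_j coef b i j x *: ((v i - x) *m (v j - x)^T).

Lemma coefE b i j x : coef b i j x = affine_fun (coef b i j 0) (coef_grad b i j) x.
Proof.
rewrite /affine_fun dot_suml -big_split; apply: eq_bigr => k _ /=.
by rewrite baryE dotZl mulrDr.
Qed.

Lemma coef_sym b i j x : (forall i j k, b i j k = b j i k) -> coef b i j x = coef b j i x.
Proof. by move=> bS; apply: eq_bigr => k _; rewrite bS. Qed.

Lemma coef_grad_sym b i j :
  (forall i j k, b i j k = b j i k) -> coef_grad b i j = coef_grad b j i.
Proof. by move=> bS; apply: eq_bigr => k _; rewrite bS. Qed.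

Lemma dot_field b x p q : dot p (bary_field b x *m q) =
  \sum_i \sum_j coef b i j x * dot p (v i - x) * dot q (v j - x).
Proof.
rewrite mulmx_suml dot_sumr; apply: eq_bigr => i _.
rewrite mulmx_suml dot_sumr; apply: eq_bigr => j _.
by rewrite -scalemxAl dotZr dot_outer mulrA.
Qed.

(** The derivative of p^T tau q in direction u by the product rule; v_i - x has derivative -u. *)
Definition field_derivative b u p q x : R :=
  \sum_i \sum_j (dot (coef_grad b i j) u * dot p (v i - x) * dot q (v j - x)
    - coef b i j x * dot p u * dot q (v j - x) - coef b i j x * dot p (v i - x) * dot q u).

(** Away from h = 0 the difference quotient is the polynomial c1 + c2 h + c3 h^2, which is
    continuous with value c1 at 0. *)
Lemma derive_cubic (f : 'cV[R]_d -> R) u x c0 c1 c2 c3 :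
  (forall h, f (h *: u + x) = c0 + h * c1 + h ^+ 2 * c2 + h ^+ 3 * c3) -> 'D_u f x = c1.
Proof.
move=> fE; apply: cvg_lim => //.
have -> : f x = c0 by have := fE 0; rewrite scale0r add0r => ->; rewrite !expr0n /=; ring.
pose p : {poly R} := c1%:P + c2 *: 'X + c3 *: 'X^2.
have pE h : p.[h] = c1 + h * c2 + h ^+ 2 * c3.
  by rewrite /p !(hornerD, hornerZ, hornerC, hornerX, hornerXn); ring.
have p0 : p.[0] = c1 by rewrite pE expr0n /= !mul0r !addr0.
have pc : (p.[h] @[h --> 0^'] --> c1)%classic.
  by rewrite -[in X in (_ --> X)%classic]p0; apply/continuous_withinNx; exact: continuous_horner.
apply: cvg_trans pc.
apply: near_eq_cvg; near=> h; rewrite /= fE pE /GRing.scale /=.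
have h0 : h != 0 by near: h; exact: nbhs_dnbhs_neq.
by field.
Unshelve. all: by end_near. Qed.

Lemma derive_field b u p q x :
  'D_u (fun y => dot p (bary_field b y *m q)) x = field_derivative b u p q x.
Proof.
pose a i := dot p (v i - x); pose c i := dot q (v i - x).
pose D i j := dot (coef_grad b i j) u.
(* B_ij, v_i - x and v_j - x are affine in h; the coefficients given are those of 1, h^2 and h^3. *)
apply: (@derive_cubic _ _ _ (\sum_i \sum_j coef b i j x * a i * c j) _
  (\sum_i \sum_j (coef b i j x * dot p u * dot q u - D i j * dot p u * c j
    - D i j * a i * dot q u))
  (\sum_i \sum_j D i j * dot p u * dot q u)) => h.
rewrite dot_field /field_derivative !mulr_sumr -!big_split /=; apply: eq_bigr => i _.
rewrite !mulr_sumr -!big_split /=; apply: eq_bigr => j _.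
have ce : coef b i j (h *: u + x) = coef b i j x + h * D i j.
  by rewrite coefE (coefE _ _ _ x) /affine_fun dotDr dotZr -/(D i j); ring.
have se r k : dot r (v k - (h *: u + x)) = dot r (v k - x) - h * dot r u.
  by rewrite !dotBr dotDr dotZr; ring.
by rewrite ce !se -/(a i) -/(c j) -/(D i j); ring.
Qed.

Lemma field_derivative_sum_p (I : finType) b u (w : I -> R) (p : I -> 'cV[R]_d) q x :
  field_derivative b u (\sum_k w k *: p k) q x = \sum_k w k * field_derivative b u (p k) q x.
Proof.
rewrite /field_derivative; under [RHS]eq_bigr => k _ do rewrite mulr_sumr.
rewrite [RHS]exchange_big /=; apply: eq_bigr => i _.
under [RHS]eq_bigr => k _ do rewrite mulr_sumr.
rewrite [RHS]exchange_big /=; apply: eq_bigr => j _.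
move: (coef_grad b i j) (coef b i j x) => g c.
rewrite !dot_suml; move: (dot g u) (dot q (v j - x)) (dot q u) => s y z.
rewrite !mulr_sumr !mulr_suml -!sumrB; apply: eq_bigr => k _.
by rewrite !dotZl; ring.
Qed.

Lemma field_derivative_sum_u (I : finType) b (u : I -> 'cV[R]_d) (w : I -> R) p q x :
  field_derivative b (\sum_k w k *: u k) p q x = \sum_k w k * field_derivative b (u k) p q x.
Proof.
rewrite /field_derivative; under [RHS]eq_bigr => k _ do rewrite mulr_sumr.
rewrite [RHS]exchange_big /=; apply: eq_bigr => i _.
under [RHS]eq_bigr => k _ do rewrite mulr_sumr.
rewrite [RHS]exchange_big /=; apply: eq_bigr => j _.
move: (coef_grad b i j) (coef b i j x) => g c.
rewrite !dot_sumr; move: (dot p (v i - x)) (dot q (v j - x)) => y z.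
rewrite !mulr_sumr !mulr_suml -!sumrB; apply: eq_bigr => k _.
by rewrite !dotZr; ring.
Qed.

Lemma field_derivative_sym b u p q x : (forall i j k, b i j k = b j i k) ->
  field_derivative b u p q x = field_derivative b u q p x.
Proof.
move=> bS; rewrite /field_derivative exchange_big /=.
apply: eq_bigr => i _; apply: eq_bigr => j _.
by rewrite (coef_sym j i x bS) (coef_grad_sym j i bS); ring.
Qed.

Lemma delta_combo (u : 'cV[R]_d) : \sum_m u m 0 *: delta_mx m 0 = u.
Proof. by rewrite [RHS]matrix_sum_delta; apply: eq_bigr => m _; rewrite big_ord1. Qed.

(** This sum is n^T div tau for symmetric or general coefficients; the factor d is the trace of the
    identity, from differentiating v_j - x. *)
Lemma sum_field_derivative b n x : \sum_m field_derivative b (delta_mx m 0) n (delta_mx m 0) x =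
  \sum_i \sum_j (dot (coef_grad b i j) (v j - x) * dot n (v i - x)
    - coef b i j x * dot n (v j - x) - d%:R * (coef b i j x * dot n (v i - x))).
Proof.
rewrite /field_derivative exchange_big /=; apply: eq_bigr => i _.
rewrite exchange_big /=; apply: eq_bigr => j _.
rewrite !sumrB; congr (_ - _ - _).
- rewrite mulr_suml; apply: eq_bigr => m _; rewrite dotC !dot_delta; ring.
- rewrite mulr_sumr; apply: eq_bigr => m _; rewrite dot_delta dotC dot_delta; ring.
- rewrite -mulr_sumr mulrC; congr (_ * _).
  rewrite (eq_bigr (fun=> 1)) => [|m _]; first by rewrite sumr_const card_ord.
  by rewrite dot_delta mxE !eqxx.
Qed.

(** As n is constant, div_F(tau n) is div(tau n) minus the normal derivative of n^T tau n, and
    div(tau n) = n^T div tau by symmetry of tau. *)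
Lemma tr_2_field b (F : {set 'I_d.+1}) x (n := facet_normal v F) :
    (forall i j k, b i j k = b j i k) -> dot n n = 1 ->
  tr_2 v F (bary_field b) x =
  2 * (\sum_m field_derivative b (delta_mx m 0) n (delta_mx m 0) x)
  - field_derivative b n n n x.
Proof.
move=> bS n1; rewrite /tr_2 -/n.
have partialE m p q : partial m (fun y => dot p (bary_field b y *m q)) x =
    field_derivative b (delta_mx m 0) p q x by exact: derive_field.
have -> : dot n (divmx (bary_field b) x) =
    \sum_m field_derivative b (delta_mx m 0) n (delta_mx m 0) x.
  transitivity (\sum_a n a 0 *
      \sum_m field_derivative b (delta_mx m 0) (delta_mx a 0) (delta_mx m 0) x).
    apply: eq_bigr => a _; rewrite mxE; congr (_ * _); apply: eq_bigr => m _.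
    rewrite -partialE; congr (partial m _ x); apply/funext => y.
    by rewrite dot_mx_delta.
  under eq_bigr => a _ do rewrite mulr_sumr.
  rewrite exchange_big; apply: eq_bigr => m _ /=.
  by rewrite -field_derivative_sum_p delta_combo.
(* Row a of the projection as a vector, so that component a of the projected w is [dot (P a) w]. *)
pose P a : 'cV[R]_d := \col_k tproj n a k.
have -> : surface_div n (fun y => bary_field b y *m n) x =
    \sum_m field_derivative b (delta_mx m 0) (delta_mx m 0) n x - field_derivative b n n n x.
  transitivity (\sum_a \sum_m tproj n a m * field_derivative b (delta_mx m 0) (P a) n x).
    apply: eq_bigr => a _; apply: eq_bigr => m _; rewrite -partialE; congr (_ * _).
    congr (partial m _ x); apply/funext => y.
    by rewrite mxE; apply: eq_bigr => k _; rewrite [X in _ = X * _]mxE.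
  have -> : field_derivative b n n n x = \sum_m n m 0 * field_derivative b (delta_mx m 0) n n x.
    by rewrite -field_derivative_sum_u delta_combo.
  rewrite exchange_big /= -sumrB.
  apply: eq_bigr => m _; rewrite -field_derivative_sum_p.
  (* The projection is symmetric and idempotent, so applying it twice leaves its column m. *)
  have -> : \sum_a tproj n a m *: P a = delta_mx m 0 - n m 0 *: n.
    have PP : (tproj n)^T *m tproj n = tproj n.
      have nn : n^T *m n = 1%:M.
        apply/matrixP => i j; rewrite !ord1 mxE mxE eqxx -[RHS]n1.
        by apply: eq_bigr => k _; rewrite mxE.
      have -> : (tproj n)^T = tproj n by rewrite /tproj linearB /= tr_scalar_mx trmx_mul trmxK.
      rewrite /tproj mulmxBl mul1mx mulmxBr mulmx1.
      by rewrite mulmxA -(mulmxA n) nn mulmx1 subrr subr0.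
    apply/matrixP => k j; rewrite ord1 summxE.
    transitivity (tproj n m k).
      rewrite -[in RHS]PP [RHS]mxE; apply: eq_bigr => a _.
      by rewrite mxE [in RHS]mxE /P [X in _ * X = _]mxE.
    by rewrite !mxE big_ord1 !mxE eqxx andbT (eq_sym k m).
  (* The type [bool] indexes the two terms of e_m - n_m n. *)
  have := @field_derivative_sum_p bool b (delta_mx m 0) (fun t => if t then 1 else - n m 0)
     (fun t => if t then delta_mx m 0 else n) n x.
  by rewrite !big_bool /= scale1r scaleNr mul1r mulNr.
rewrite [X in _ + (X - _)](eq_bigr
  (fun m => field_derivative b (delta_mx m 0) n (delta_mx m 0) x)).
  by ring.
by move=> m _; rewrite field_derivative_sym.
Qed.

(** For x on the facet opposite to v_i, n^T (v_k - x) is -h for k = i and 0 otherwise, so sums over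
    vertices collapse to the index i. *)
Lemma sum_pick (i : 'I_d.+1) (h : R) (F : 'I_d.+1 -> R) :
  \sum_k F k * (- (h * (k == i)%:R)) = - (h * F i).
Proof.
rewrite (bigD1 i) //= eqxx mulr1 big1 => [|k /negbTE->]; first by ring.
by rewrite mulr0 oppr0 mulr0.
Qed.

Lemma sum2_pickl (i : 'I_d.+1) (h : R) (F : 'I_d.+1 -> 'I_d.+1 -> R) :
  \sum_k \sum_l F k l * (- (h * (k == i)%:R)) = - (h * \sum_l F i l).
Proof.
rewrite -(sum_pick i h (fun k => \sum_l F k l)).
by apply: eq_bigr => k _; rewrite mulr_suml.
Qed.

Lemma sum2_pickr (i : 'I_d.+1) (h : R) (F : 'I_d.+1 -> 'I_d.+1 -> R) :
  \sum_k \sum_l F k l * (- (h * (l == i)%:R)) = - (h * \sum_k F k i).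
Proof. by rewrite exchange_big sum2_pickl. Qed.

(** Twice n^T div tau contributes 2 (d + 2) h sum_l B_il(x), and the normal derivative of n^T tau n
    takes off 2 h sum_l B_il(x). *)
Lemma tr_2_field_facet b (F : {set 'I_d.+1}) x i h (n := facet_normal v F) :
    (forall i j k, b i j k = b j i k) -> dot n n = 1 ->
    (forall k, dot n (v k - x) = - (h * (k == i)%:R)) ->
  tr_2 v F (bary_field b) x =
  h * (2 * d.+1%:R * (\sum_l coef b i l x) - 2 * (\sum_l coef b i l (v l))
       - h * dot (coef_grad b i i) n).
Proof.
move=> bS n1 hn; rewrite tr_2_field // -/n sum_field_derivative /field_derivative n1.
have sum2B (X Y Z : 'I_d.+1 -> 'I_d.+1 -> R) : \sum_k \sum_l (X k l - Y k l - Z k l) =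
    \sum_k \sum_l X k l - \sum_k \sum_l Y k l - \sum_k \sum_l Z k l.
  by under eq_bigr => k _ do rewrite !sumrB; rewrite !sumrB.
pose a k : R := - (h * (k == i)%:R).
have S1 : \sum_k coef b k i x = \sum_l coef b i l x.
  by apply: eq_bigr => k _; rewrite coef_sym.
(* The gradient paired with v_l - x is the increment of B_kl from x to v_l; this is the source of
   the values B_il(v_l). *)
have e1 : \sum_k \sum_l dot (coef_grad b k l) (v l - x) * dot n (v k - x) =
    h * (\sum_l coef b i l x) - h * (\sum_l coef b i l (v l)).
  transitivity (\sum_k \sum_l (coef b k l (v l) - coef b k l x) * a k).
    apply: eq_bigr => k _; apply: eq_bigr => l _; rewrite hn; congr (_ * _).
    by rewrite dotBr (coefE _ _ _ x) (coefE _ _ _ (v l)) /affine_fun; ring.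
  by rewrite sum2_pickl sumrB; ring.
have e2 : \sum_k \sum_l coef b k l x * dot n (v l - x) = - (h * \sum_l coef b i l x).
  rewrite -S1 -(sum2_pickr i h (fun k l => coef b k l x)).
  by apply: eq_bigr => k _; apply: eq_bigr => l _; rewrite hn.
have e3 : \sum_k \sum_l coef b k l x * dot n (v k - x) = - (h * \sum_l coef b i l x).
  by rewrite -(sum2_pickl i h (fun k l => coef b k l x));
    apply: eq_bigr => k _; apply: eq_bigr => l _; rewrite hn.
have e4 : \sum_k \sum_l dot (coef_grad b k l) n * dot n (v k - x) * dot n (v l - x) =
    h ^+ 2 * dot (coef_grad b i i) n.
  transitivity (\sum_k \sum_l (dot (coef_grad b k l) n * a k) * a l).
    by apply: eq_bigr => k _; apply: eq_bigr => l _; rewrite !hn.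
  by rewrite sum2_pickr sum_pick; ring.
rewrite !sum2B e1 e2 e4.
have -> : \sum_k \sum_l d%:R * (coef b k l x * dot n (v k - x)) =
    d%:R * - (h * \sum_l coef b i l x).
  by rewrite -e3 mulr_sumr; apply: eq_bigr => k _; rewrite mulr_sumr.
have -> : \sum_k \sum_l coef b k l x * 1 * dot n (v l - x) = - (h * \sum_l coef b i l x).
  by rewrite -e2; apply: eq_bigr => k _; apply: eq_bigr => l _; rewrite mulr1.
have -> : \sum_k \sum_l coef b k l x * dot n (v k - x) * 1 = - (h * \sum_l coef b i l x).
  by rewrite -e3; apply: eq_bigr => k _; apply: eq_bigr => l _; rewrite mulr1.
by rewrite -[d.+1%:R]natr1; ring.
Qed.

End BarycentricFields.

(** * Outward normals of the facets, and of the codimension-two faces within them *)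

Section Normals.
Context {R : realType} {d : nat} (v : 'I_d.+1 -> 'cV[R]_d).
Hypothesis hv : affinely_independent v.
Implicit Types (A B : {set 'I_d.+1}) (x u m n : 'cV[R]_d).

(** [outward_normal] is a choice, hence meaningful once some vector qualifies; up to normalization,
    [m] is one. *)
Lemma outward_normalP A B m :
    tangent v A m -> (forall u, tangent v B u -> dot m u = 0) ->
    (forall i j, i \in A -> i \notin B -> j \in B -> dot m (v i - v j) < 0) -> m != 0 ->
  is_outward_normal v A B (outward_normal v A B).
Proof.
move=> [c c0 cm] mB mlt m0; apply: xgetPex.
have s0 : 0 < (Num.sqrt (dot m m))^-1 by rewrite invr_gt0 sqrtr_gt0 dot_gt0.
exists ((Num.sqrt (dot m m))^-1 *: m); split.
- exists (fun i => (Num.sqrt (dot m m))^-1 * c i); first by rewrite -mulr_sumr c0 mulr0.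
  by rewrite cm scaler_sumr; apply: eq_bigr => i _; rewrite scalerA.
- by move=> u /mB mu; rewrite dotZl mu mulr0.
- rewrite dotZl dotZr mulrA -expr2 exprVn sqr_sqrtr ?dot_ge0 // mulVf //.
  by rewrite gt_eqF // dot_gt0.
- by move=> i j iA iB jB; rewrite dotZl pmulr_rlt0 // mlt.
Qed.

Lemma tangent_edge A i j : i \in A -> j \in A -> tangent v A (v i - v j).
Proof.
move=> iA jA; exists (fun k => (k == i)%:R - (k == j)%:R).
  rewrite sumrB (bigD1 i) //= eqxx (bigD1 j jA) /= eqxx.
  rewrite !big1 ?addr0 ?subrr // => k /andP[_] /negbTE->.
    by [].
  by [].
under eq_bigr => k _ do rewrite scalerBl.
rewrite sumrB (bigD1 i) //= eqxx scale1r (bigD1 j jA) /= eqxx scale1r !big1 ?addr0 //.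
  by move=> k /andP[_] /negbTE->; rewrite scale0r.
by move=> k /andP[_] /negbTE->; rewrite scale0r.
Qed.

(** Since [m] is orthogonal to the face, a point of the face may be replaced by a vertex. *)
Lemma dot_hull A m x j w : (forall k, k \in A -> dot m (v k - v j) = 0) ->
  hull v A x -> dot m (w - x) = dot m (w - v j).
Proof.
move=> mA [c [_ c1 ->]].
suff -> : \sum_(k in A) c k *: v k = v j + \sum_(k in A) c k *: (v k - v j).
  rewrite !dotBr dotDr dot_sumr big1 ?addr0 // => k kA.
  by rewrite dotZr mA // mulr0.
under [in RHS]eq_bigr => k _ do rewrite scalerBr.
by rewrite sumrB -scaler_suml c1 scale1r addrC subrK.
Qed.

Lemma hull_sub A B x : A \subset B -> hull v A x -> hull v B x.
Proof.
move=> AB [c [c0 c1 ->]]; exists (fun i => if i \in A then c i else 0); split.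
- by move=> i _; case: ifP => // /c0.
- rewrite -big_mkcondr -[RHS]c1; apply: eq_bigl => i.
  by apply: andb_idl; exact: (fintype.subsetP AB).
- rewrite [RHS](eq_bigr (fun i => if i \in A then c i *: v i else 0)); last first.
    by move=> i _; case: ifP => // _; rewrite scale0r.
  rewrite -big_mkcondr; apply: eq_bigl => i.
  by apply/esym/andb_idl; exact: (fintype.subsetP AB).
Qed.

(** With its converse below: the tangent space of a face is the common kernel of the gradients of
    the coordinates that vanish on it. *)
Lemma grad_tangent B i u : i \notin B -> tangent v B u -> dot (bary_grad v i) u = 0.
Proof.
move=> iB [c c0 ->].
have : \sum_(k in B) c k * dot (bary_grad v i) (v k) = \sum_(k in B) c k * - bary v i 0.
  apply: eq_bigr => k kB; congr (_ * _); apply/eqP; rewrite -addr_eq0 addrC -baryE.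
  by rewrite bary_vertex //; have [ik|//] := eqVneq i k; by rewrite ik kB in iB.
rewrite -mulr_suml c0 mul0r => <-; rewrite dot_sumr.
by apply: eq_bigr => k _; rewrite dotZr.
Qed.

Lemma tangent_grad B u : (forall i, i \notin B -> dot (bary_grad v i) u = 0) -> tangent v B u.
Proof.
move=> uB; exists (fun k => dot (bary_grad v k) u).
  rewrite -[RHS](sum_grad hv u) [RHS](bigID (mem B)) /= [X in _ = _ + X]big1 ?addr0 //.
rewrite -[LHS](grad_combo hv u) [LHS](bigID (mem B)) /= [X in _ + X = _]big1 ?addr0 //.
by move=> k /uB ->; rewrite scale0r.
Qed.

(** The witness is minus the gradient of the i-th coordinate, and [h] is the height of v_i over the
    facet. *)
Lemma facet_normalP i (n := facet_normal v (~: [set i])) : (0 < d)%N ->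
  exists2 h, 0 < h & dot n n = 1 /\
    forall k l, l != i -> dot n (v k - v l) = - (h * (k == i)%:R).
Proof.
move=> d0; have [j ji] : exists j, j != i.
  have : (0 < #|~: [set i]|)%N by have := cardsC [set i]; rewrite cards1 card_ord; lia.
  by move=> /card_gt0P[j]; rewrite !inE; exists j.
have [_ nt nn nlt] : is_outward_normal v [set: _]%SET (~: [set i]) n.
  apply: (@outward_normalP _ _ (- bary_grad v i)).
  - by apply: tangent_grad => k; rewrite inE.
  - by move=> u uF; rewrite dotNl (@grad_tangent _ i _ _ uF) ?oppr0 // !inE eqxx.
  - move=> k l _; rewrite !inE negbK => /eqP-> li.
    by rewrite dotNl grad_vertex // eqxx eq_sym (negbTE li) subr0 oppr_lt0 ltr01.
  - apply/eqP => e; have := grad_vertex hv i i j.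
    rewrite -[bary_grad v i]opprK e oppr0 dotC dot0r eqxx eq_sym (negbTE ji) subr0.
    by move=> /eqP; rewrite eq_sym oner_eq0.
have inF k : k != i -> k \in ~: [set i] by rewrite !inE.
exists (- dot n (v i - v j)).
  by rewrite oppr_gt0 nlt ?inE ?eqxx.
split=> // k l li; case: eqP => [->|/eqP ki]; last first.
  by rewrite mulr0 oppr0 nt //; apply: tangent_edge; exact: inF.
rewrite mulr1 opprK; apply/eqP; rewrite -subr_eq0 -dotBr.
have -> : v i - v l - (v i - v j) = v j - v l by rewrite opprB addrC addrA subrK.
by rewrite nt //; apply: tangent_edge; exact: inF.
Qed.

(** [h] is the height of v_j within the facet opposite to v_i. The component [s] along v_i has no
    prescribed sign; in the trace it only multiplies B_ii. *)
Lemma edge_normalP i j (m := outward_normal v (~: [set i]) (~: [set i; j])) :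
    i != j -> (1 < d)%N ->
  exists2 h, 0 < h & exists s, forall l, l \notin [set i; j] ->
    [/\ dot m (v j - v l) = - h, dot m (v i - v l) = s &
        forall k, k \notin [set i; j] -> dot m (v k - v l) = 0].
Proof.
move=> ij d1; have [l0 hl0] : exists l0, l0 \notin [set i; j].
  have : (0 < #|~: [set i; j]|)%N.
    by have := cardsC [set i; j]; rewrite cards2 ij card_ord; lia.
  by move=> /card_gt0P[l]; rewrite inE; exists l.
have g0 l : l \notin [set i; j] -> dot (bary_grad v i) (v j - v l) = 0 /\
    dot (bary_grad v j) (v j - v l) = 1.
  rewrite !inE negb_or => /andP[li lj]; rewrite !grad_vertex // eqxx (negbTE ij).
  by rewrite (eq_sym i) (negbTE li) (eq_sym j) (negbTE lj) !subr0.
have gi0 : dot (bary_grad v i) (bary_grad v i) != 0.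
  apply/eqP => /dot_eq0 e; have := grad_vertex hv i i j.
  by rewrite e dotC dot0r eqxx (negbTE ij) subr0 => /eqP; rewrite eq_sym oner_eq0.
(* A Gram-Schmidt step: removing the component along the i-th gradient makes the j-th one tangent to
   the facet opposite to v_i. *)
pose a := dot (bary_grad v i) (bary_grad v j) / dot (bary_grad v i) (bary_grad v i).
pose m0 := - (bary_grad v j - a *: bary_grad v i).
have m0E l : l \notin [set i; j] -> dot m0 (v j - v l) = - 1.
  by move=> /g0[e1 e2]; rewrite dotNl dotBl dotZl e1 e2 mulr0 subr0.
have [_ mt _ mlt] : is_outward_normal v (~: [set i]) (~: [set i; j]) m.
  apply: (@outward_normalP _ _ m0).
  - apply: tangent_grad => k; rewrite !inE negbK => /eqP->.
    by rewrite dotNr dotBr dotZr /a divfK // subrr oppr0.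
  - move=> u ue; rewrite dotNl dotBl dotZl !(@grad_tangent _ _ _ _ ue) ?mulr0 ?subr0 ?oppr0 //.
      by rewrite !inE eqxx.
    by rewrite !inE eqxx orbT.
  - move=> k l; rewrite !inE negbK => /negbTE-> /= /eqP-> hl.
    by rewrite m0E ?oppr_lt0 ?ltr01 // !inE.
  - apply/eqP => e; have := m0E _ hl0; rewrite e dotC dot0r => /eqP.
    by rewrite eq_sym oppr_eq0 oner_eq0.
have me k l : k \notin [set i; j] -> l \notin [set i; j] -> dot m (v k - v l) = 0.
  by move=> hk hl; apply/mt/tangent_edge; rewrite inE.
have shift k l : l \notin [set i; j] -> dot m (v k - v l) = dot m (v k - v l0).
  by move=> hl; rewrite -[v k - v l](subrKA (v l0)) [LHS]dotDr (me l0 l) ?addr0.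
exists (- dot m (v j - v l0)).
  rewrite oppr_gt0; apply: mlt; last by rewrite inE.
    by rewrite !inE eq_sym.
  by rewrite !inE eqxx orbT.
exists (dot m (v i - v l0)) => l hl; split; rewrite ?opprK ?shift // => k hk.
by rewrite me.
Qed.

End Normals.

(** * Traces of the fields on the faces *)

Section FieldTraces.
Context {R : realType} {d : nat} (v : 'I_d.+1 -> 'cV[R]_d).
Hypothesis hv : affinely_independent v.
Implicit Types (b : 'I_d.+1 -> 'I_d.+1 -> 'I_d.+1 -> R) (x : 'cV[R]_d) (A : {set 'I_d.+1}).

Lemma affine_on_coef A b i j : affine_on v A (coef v b i j).
Proof.
move=> c _ c1; rewrite coefE /affine_fun dot_sumr -[X in X + _]mul1r -c1 mulr_suml -big_split.
by apply: eq_bigr => k _ /=; rewrite (coefE _ _ _ _ (v k)) /affine_fun dotZr mulrDr.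
Qed.

Lemma affine_onD A f g : affine_on v A f -> affine_on v A g -> affine_on v A (fun x => f x + g x).
Proof.
move=> hf hg c c0 c1; rewrite hf // hg // -big_split.
by apply: eq_bigr => k _; rewrite mulrDr.
Qed.

Lemma affine_onZ A a f : affine_on v A f -> affine_on v A (fun x => a * f x).
Proof.
move=> hf c c0 c1; rewrite hf // mulr_sumr.
by apply: eq_bigr => k _; rewrite mulrCA.
Qed.

Lemma affine_on_cst A a : affine_on v A (fun=> a).
Proof. by move=> c _ c1; rewrite -mulr_suml c1 mul1r. Qed.

Lemma affine_on_sum A (I : finType) (f : I -> 'cV[R]_d -> R) :
  (forall i, affine_on v A (f i)) -> affine_on v A (fun x => \sum_i f i x).
Proof.
move=> hf c c0 c1; under eq_bigr => i _ do rewrite hf //.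
by rewrite exchange_big; apply: eq_bigr => k _; rewrite mulr_sumr.
Qed.

Lemma affine_on_ext A f g :
  (forall x, hull v A x -> f x = g x) -> affine_on v A g -> affine_on v A f.
Proof.
move=> fg hg c c0 c1; rewrite fg; last by exists c.
by rewrite hg //; apply: eq_bigr => k kA; rewrite fg //; exact: hull_vertex.
Qed.

Lemma coef_vertex b i j k : coef v b i j (v k) = b i j k.
Proof.
rewrite /coef (bigD1 k) //= bary_vertex // eqxx mulr1 big1 ?addr0 // => l /negbTE lk.
by rewrite bary_vertex // lk mulr0.
Qed.

Lemma dot_facet_normal i h n x : (0 < d)%N ->
  (forall k l, l != i -> dot n (v k - v l) = - (h * (k == i)%:R)) ->
  hull v (~: [set i]) x -> forall k, dot n (v k - x) = - (h * (k == i)%:R).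
Proof.
move=> d0 hn hx k; have [j ji] : exists j, j != i.
  have : (0 < #|~: [set i]|)%N by have := cardsC [set i]; rewrite cards1 card_ord; lia.
  by move=> /card_gt0P[j]; rewrite !inE; exists j.
rewrite (dot_hull (j := j) _ _ hx) ?hn // => l; rewrite !inE => /negbTE li.
by rewrite hn // li mulr0 oppr0.
Qed.

Lemma tr_nn_facet b i : (0 < d)%N -> exists2 h, 0 < h &
  forall x, hull v (~: [set i]) x -> tr_nn v (~: [set i]) (bary_field v b) x = h * coef v b i i x.
Proof.
move=> d0; have [h h0 [_ hn]] := facet_normalP hv i d0.
exists (h ^+ 2) => [|x hx]; first by rewrite exprn_gt0.
have hnx := dot_facet_normal d0 hn hx.
rewrite /tr_nn dot_field.
under eq_bigr => k _ do under eq_bigr => l _ do rewrite !hnx.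
by rewrite sum2_pickr sum_pick; ring.
Qed.

(** [c] is the contribution of the normal derivative of B_ii. *)
Lemma tr_2_facet b i : (0 < d)%N -> (forall i j k, b i j k = b j i k) ->
  exists2 h, 0 < h & exists2 c, ((forall k, b i i k = 0) -> c = 0) &
  forall x, hull v (~: [set i]) x -> tr_2 v (~: [set i]) (bary_field v b) x =
    h * (d.+1%:R * (\sum_l coef v b i l x) - \sum_l b i l l) + c.
Proof.
move=> d0 bS; have [h h0 [n1 hn]] := facet_normalP hv i d0.
exists (2 * h); first by rewrite mulr_gt0.
exists (- (h ^+ 2 * dot (coef_grad v b i i) (facet_normal v (~: [set i])))).
  move=> b0; have -> : coef_grad v b i i = 0.
    by apply: big1 => k _; rewrite b0 scale0r.
  by rewrite dotC dot0r mulr0 oppr0.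
move=> x hx; rewrite (tr_2_field_facet bS n1 (dot_facet_normal d0 hn hx)).
under [X in _ - 2 * X]eq_bigr => l _ do rewrite coef_vertex.
by ring.
Qed.

(** Exactly the facets opposite to v_i and v_j contain this face. Each gives a positive multiple of
    B_ij, with a multiple of B_ii or B_jj. *)
Lemma tr_e_edge b i j : (1 < d)%N -> i != j -> (forall i j k, b i j k = b j i k) ->
  exists2 h, 0 < h & exists s t, forall x, hull v (~: [set i; j]) x ->
    tr_e v (~: [set i; j]) (bary_field v b) x =
    h * coef v b i j x + s * coef v b i i x + t * coef v b j j x.
Proof.
move=> d1 ij bS; have d0 : (0 < d)%N by exact: ltnW.
have half a c (m := outward_normal v (~: [set a]) (~: [set a; c])) : a != c ->
    exists2 h, 0 < h & exists s, forall x, hull v (~: [set a; c]) x ->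
      dot m (bary_field v b x *m facet_normal v (~: [set a])) =
      h * coef v b a c x + s * coef v b a a x.
  move=> ac; have [h h0 [_ hn]] := facet_normalP hv a d0.
  have [p p0 [s hm]] := edge_normalP hv ac d1.
  exists (h * p); first by rewrite mulr_gt0.
  exists (- (h * s)) => x hx.
  have [l0 hl0] : exists l0, l0 \notin [set a; c].
    have : (0 < #|~: [set a; c]|)%N.
      by have := cardsC [set a; c]; rewrite cards2 ac card_ord; lia.
    by move=> /card_gt0P[l]; rewrite inE; exists l.
  have [mc ma mk] := hm _ hl0.
  have hmx k : dot m (v k - x) = dot m (v k - v l0).
    by apply: (dot_hull _ _ hx) => l; rewrite inE => /mk.
  have hxa : hull v (~: [set a]) x.
    by apply: hull_sub hx; rewrite finset.setCS finset.sub1set !inE eqxx.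
  rewrite dot_field.
  (* The facet normal forces l = a; then k = c gives the multiple h p of B_ac, and k = a gives
     B_aa. *)
  transitivity (\sum_k \sum_l (coef v b k l x * dot m (v k - v l0)) * (- (h * (l == a)%:R))).
    by apply: eq_bigr => k _; apply: eq_bigr => l _; rewrite hmx (dot_facet_normal d0 hn hxa).
  rewrite sum2_pickr (bigD1 a) //= (bigD1 c) 1?eq_sym //= mc ma big1 => [|k /andP[ka kc]].
    by rewrite (coef_sym v c a x bS); ring.
  by rewrite mk ?mulr0 // !inE negb_or ka kc.
have [h1 h10 [s1 e1]] := half i j ij.
have ji : j != i by rewrite eq_sym.
have [h2 h20 [s2 e2]] := half j i ji.
exists (h1 + h2); first by rewrite addr_gt0.
exists s1, s2 => x hx.
have card1 a : #|~: [set a : 'I_d.+1]| = d.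
  by have := cardsC [set a]; rewrite cards1 card_ord; lia.
rewrite /tr_e (bigD1 (~: [set i])) /=; last first.
  by rewrite card1 eqxx finset.setCS finset.sub1set !inE eqxx.
rewrite (bigD1 (~: [set j])) /=; last first.
  rewrite card1 eqxx finset.setCS finset.sub1set !inE eqxx orbT /=.
  by apply: contra_neq ij => /finset.setC_inj/finset.set1_inj.
rewrite big1 ?addr0 => [|F /andP[/andP[/andP[/eqP cF eF] Fi] Fj]]; last first.
  have /eqP/cards1P[k Fk] : #|~: F| = 1%N by have := cardsC F; rewrite cF card_ord; lia.
  have FE : F = ~: [set k] by rewrite -Fk finset.setCK.
  move: eF Fi Fj; rewrite FE finset.setCS finset.sub1set !inE => /orP[]/eqP->.
    by rewrite eqxx.
  by rewrite eqxx.
rewrite e1 // (finset.setUC [set i]) e2; last by rewrite finset.setUC.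
by rewrite (coef_sym v j i x bS); ring.
Qed.

(** Serves twice: for unisolvence and for the linear independence of the normalized fields. *)
Lemma field_traces_eq0 b : (1 < d)%N -> (forall i j k, b i j k = b j i k) ->
    (forall i, b i i i = 0) ->
    (forall i j k, i != j -> k \notin [set i; j] ->
       tr_e v (~: [set i; j]) (bary_field v b) (v k) = 0) ->
    (forall i k, k != i -> tr_nn v (~: [set i]) (bary_field v b) (v k) = 0) ->
    (forall i k, k != i -> tr_2 v (~: [set i]) (bary_field v b) (v k) = 0) ->
  forall i j k, b i j k = 0.
Proof.
move=> d1 bS biii he hnn h2; have d0 : (0 < d)%N by exact: ltnW.
have vhull i k : k != i -> hull v (~: [set i]) (v k).
  by move=> ki; apply: hull_vertex; rewrite !inE.
have bii i k : b i i k = 0.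
  have [->//|ki] := eqVneq k i; have [h h0 hE] := tr_nn_facet b i d0.
  have := hnn i k ki; rewrite hE ?coef_vertex; last exact: vhull.
  by move=> /eqP; rewrite mulf_eq0 gt_eqF // => /eqP.
have bijk i j k : i != j -> k != i -> k != j -> b i j k = 0.
  move=> ij ki kj; have [h h0 [s [t hE]]] := tr_e_edge d1 ij bS.
  have kij : k \notin [set i; j] by rewrite !inE negb_or ki kj.
  have := he i j k ij kij; rewrite hE ?coef_vertex; last by apply: hull_vertex; rewrite inE.
  rewrite !bii !mulr0 !addr0 => /eqP.
  by rewrite mulf_eq0 gt_eqF // => /eqP.
have bikk i k : k != i -> d.+1%:R * b i k k = \sum_l b i l l.
  move=> ki; have [h h0 [c c0 hE]] := tr_2_facet i d0 bS.
  have := h2 i k ki; rewrite hE; last exact: vhull.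
  rewrite (c0 (bii i)) addr0 => /eqP; rewrite mulf_eq0 gt_eqF //= subr_eq0 => /eqP <-.
  (* At v_k all B_il with l != k vanish, so the sum of the B_il reduces to b_ikk. *)
  congr (_ * _); rewrite (bigD1 k) //= coef_vertex big1 ?addr0 // => l lk.
  rewrite coef_vertex; have [->//|li] := eqVneq l i.
  by apply: bijk; rewrite // eq_sym.
have S0 i : \sum_l b i l l = 0.
  have : d.+1%:R * (\sum_l b i l l) = d%:R * (\sum_l b i l l).
    have e : \sum_l b i l l = \sum_(l | l != i) b i l l by rewrite (bigD1 i) //= bii add0r.
    rewrite [in LHS]e mulr_sumr (eq_bigr (fun=> \sum_l b i l l)) => [|l /bikk //].
    rewrite sumr_const -[LHS]mulr_natl; congr (_%:R * _).
    by have := cardC1 i; rewrite card_ord.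
  rewrite -natr1 => e; lra.
have {}bikk i k : k != i -> b i k k = 0.
  move=> ki; have := bikk i k ki; rewrite S0 => /eqP.
  by rewrite mulf_eq0 pnatr_eq0 => /eqP.
move=> i j k; have [<-//|ij] := eqVneq i j.
have [->|ki] := eqVneq k i; first by rewrite bS bikk.
have [->|kj] := eqVneq k j; first by rewrite bikk // eq_sym.
exact: bijk.
Qed.

End FieldTraces.

(** * The shape functions are the fields with symmetric coefficients *)

Section SigmaFields.
Context {R : realType} {d : nat} (v : 'I_d.+1 -> 'cV[R]_d).
Hypothesis hv : affinely_independent v.
Implicit Types (b : 'I_d.+1 -> 'I_d.+1 -> 'I_d.+1 -> R) (x : 'cV[R]_d).

(** Affine maps by interpolation from the vertices: linear operations visibly preserve this form,
    and the vertex values can serve as coefficients b_ijk. *)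
Definition affine_mx m n (F : 'cV[R]_d -> 'M[R]_(m, n)) : Prop :=
  forall x, F x = \sum_k bary v k x *: F (v k).

Lemma Pk1_setT_baryP (f : 'cV[R]_d -> R) :
  Pk 1 setT f <-> forall x, f x = \sum_k bary v k x * f (v k).
Proof.
rewrite Pk1_setTP; split=> [[c [g ->]] x|h].
  by rewrite (affine_fun_bary hv); apply: eq_bigr => k _; rewrite mulrC.
exists (\sum_k bary v k 0 * f (v k)), (\sum_k f (v k) *: bary_grad v k).
apply/funext => x; rewrite h /affine_fun dot_suml -big_split; apply: eq_bigr => k _ /=.
by rewrite baryE dotZl; ring.
Qed.

Lemma affine_mxP m n (F : 'cV[R]_d -> 'M[R]_(m, n)) :
  affine_mx F <-> forall i j, Pk 1 setT (fun x => F x i j).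
Proof.
split=> [h i j|h x].
  apply/Pk1_setT_baryP => x; rewrite h summxE.
  by apply: eq_bigr => k _; rewrite mxE.
apply/matrixP => i j; have /Pk1_setT_baryP -> := h i j; rewrite summxE.
by apply: eq_bigr => k _; rewrite mxE.
Qed.

Lemma Hk1_setT_baryP (f : 'cV[R]_d -> R) :
  Hk 1 setT f <-> Pk 1 setT f /\ f 0 = 0.
Proof.
rewrite Hk1_setTP Pk1_setTP; split=> [[g ->]|[[c [g fE]] f0]].
  split; last by rewrite dot0r.
  by exists 0, g; apply/funext => x; rewrite /affine_fun add0r.
exists g; apply/funext => x; move: f0; rewrite fE /affine_fun dot0r addr0 => ->.
by rewrite add0r.
Qed.

Lemma affine_mxD m n (F G : 'cV[R]_d -> 'M[R]_(m, n)) :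
  affine_mx F -> affine_mx G -> affine_mx (fun x => F x + G x).
Proof.
move=> hF hG x; rewrite hF hG -big_split.
by apply: eq_bigr => k _; rewrite scalerDr.
Qed.

Lemma affine_mxN m n (F : 'cV[R]_d -> 'M[R]_(m, n)) :
  affine_mx F -> affine_mx (fun x => - F x).
Proof.
by move=> hF x; rewrite hF -sumrN; apply: eq_bigr => k _; rewrite scalerN.
Qed.

Lemma affine_mx_cst m n (M : 'M[R]_(m, n)) : affine_mx (fun=> M).
Proof. by move=> x; rewrite -scaler_suml (sum_bary hv) scale1r. Qed.

Lemma affine_mx_id : affine_mx id.
Proof. by move=> x; rewrite (bary_combo hv). Qed.

Lemma affine_mxZ m n a (F : 'cV[R]_d -> 'M[R]_(m, n)) :
  affine_mx F -> affine_mx (fun x => a *: F x).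
Proof.
by move=> hF x; rewrite hF scaler_sumr; apply: eq_bigr => k _; rewrite !scalerA mulrC.
Qed.

Lemma affine_mx_mull m n p (M : 'M[R]_(m, n)) (F : 'cV[R]_d -> 'M[R]_(n, p)) :
  affine_mx F -> affine_mx (fun x => M *m F x).
Proof.
by move=> hF x; rewrite hF mulmx_sumr; apply: eq_bigr => k _; rewrite -scalemxAr.
Qed.

Lemma affine_mx_tr m n (F : 'cV[R]_d -> 'M[R]_(m, n)) :
  affine_mx F -> affine_mx (fun x => (F x)^T).
Proof.
by move=> hF x; rewrite hF linear_sum; apply: eq_bigr => k _; rewrite linearZ.
Qed.

Lemma affine_mx_mulr m n p (M : 'M[R]_(n, p)) (F : 'cV[R]_d -> 'M[R]_(m, n)) :
  affine_mx F -> affine_mx (fun x => F x *m M).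
Proof.
by move=> hF x; rewrite hF mulmx_suml; apply: eq_bigr => k _; rewrite -scalemxAl.
Qed.

Lemma affine_mx_scale m n (M : 'M[R]_(m, n)) (f : 'cV[R]_d -> R) :
  Pk 1 setT f -> affine_mx (fun x => f x *: M).
Proof.
move=> /Pk1_setT_baryP hf x; rewrite hf scaler_suml.
by apply: eq_bigr => k _; rewrite scalerA.
Qed.

Definition coef_mx b x : 'M[R]_d.+1 := \matrix_(i, j) coef v b i j x.

Definition vertices : 'M[R]_(d, d.+1) := \matrix_(i, j) v j i 0.

Definition edges x : 'M[R]_(d, d.+1) := vertices - x *m const_mx 1.

Lemma edges_mul x (w : 'cV[R]_d.+1) : edges x *m w = \sum_i w i 0 *: (v i - x).
Proof.
apply/matrixP => i j; rewrite ord1 summxE mxE; apply: eq_bigr => k _.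
by rewrite !mxE big_ord1 mxE mulr1 mulrC.
Qed.

(** Writes the field as a congruence E B E^T, E having the columns v_i - x, so that what follows is
    matrix algebra. *)
Lemma bary_field_mx b x : bary_field v b x = edges x *m coef_mx b x *m (edges x)^T.
Proof.
have eE i k : edges x i k = (v k - x) i 0 by rewrite !mxE big_ord1 mxE mulr1.
apply/matrixP => i j; rewrite summxE mxE.
transitivity (\sum_k \sum_l coef v b k l x * edges x i k * edges x j l).
  apply: eq_bigr => k _; rewrite summxE; apply: eq_bigr => l _.
  by rewrite mxE mxE big_ord1 [(_^T) _ _]mxE !eE mulrA.
rewrite exchange_big; apply: eq_bigr => l _; rewrite [(_^T) _ _]mxE [X in _ = X * _]mxE.
by rewrite mulr_suml; apply: eq_bigr => k _; rewrite [coef_mx _ _ _ _]mxE; ring.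
Qed.

Lemma affine_coef_mx b : affine_mx (coef_mx b).
Proof.
apply/affine_mxP => i j; apply/Pk1_setTP; exists (coef v b i j 0), (coef_grad v b i j).
by apply/funext => x; rewrite mxE coefE.
Qed.

Lemma coef_mx_of_affine (F : 'cV[R]_d -> 'M[R]_d.+1) : affine_mx F ->
  forall x, coef_mx (fun i j k => F (v k) i j) x = F x.
Proof.
move=> hF x; rewrite [RHS]hF; apply/matrixP => i j; rewrite mxE summxE.
by apply: eq_bigr => k _; rewrite mxE mulrC.
Qed.

Lemma coef_mx_sym b x : (forall i j k, b i j k = b j i k) -> (coef_mx b x)^T = coef_mx b x.
Proof. by move=> bS; apply/matrixP => i j; rewrite !mxE coef_sym. Qed.

(** There are constant G and X with E G = 1 and E X = x. Replacing the outer factors 1 and x of a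
    shape function by E G and E X leaves an affine symmetric matrix between E and E^T. *)
Lemma Sigma1pp_bary_field tau : Sigma1pp tau ->
  exists2 b, (forall i j k, b i j k = b j i k) & tau = bary_field v b.
Proof.
move=> [t1 [_ [_ [[t1P t1S] [q qP ->] [r rP ->] ->]]]].
pose G : 'M[R]_(d.+1, d) := \matrix_(i, j) bary_grad v i j 0.
pose X : 'cV[R]_d.+1 := - \col_i bary v i 0.
have EG x : edges x *m G = 1%:M.
  apply/matrixP => i j; have := grad_edges hv (delta_mx j 0) x.
  move=> /matrixP/(_ i 0); rewrite summxE [RHS]mxE eqxx andbT => e.
  rewrite [RHS]mxE -e mxE; apply: eq_bigr => k _.
  by rewrite dotC dot_delta !mxE big_ord1 mxE mulr1 mulrC.
have EX x : edges x *m X = x.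
  rewrite mulmxN edges_mul; under eq_bigr => i _ do rewrite mxE.
  by rewrite (bary_edges hv) sub0r opprK.
pose N x := G *m t1 x *m G^T + 2^-1 *: (X *m (G *m q x)^T + (G *m q x) *m X^T)
   + r x *: (X *m X^T).
have qA : affine_mx q by apply/affine_mxP => i j; rewrite ord1; have /Hk1_setT_baryP[] := qP i.
have NA : affine_mx N.
  apply: affine_mxD; first apply: affine_mxD.
  - by apply/affine_mx_mulr/affine_mx_mull/affine_mxP.
  - apply/affine_mxZ/affine_mxD.
      exact/affine_mx_mull/affine_mx_tr/affine_mx_mull.
    exact/affine_mx_mulr/affine_mx_mull.
  - by apply: affine_mx_scale; have /Hk1_setT_baryP[] := rP.
have NS x : (N x)^T = N x.
  rewrite /N !(linearD, linearZ) /= !trmx_mul !trmxK t1S !mulmxA.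
  by rewrite scalerDr [X in _ + X + _]addrC.
exists (fun i j k => N (v k) i j) => [i j k|].
  by have /matrixP/(_ j i) := NS (v k); rewrite [X in X = _]mxE.
apply/funext => x; rewrite bary_field_mx coef_mx_of_affine // /N.
move: (EG x) (EX x) => {EG EX}; move: (edges x) => E EG EX.
rewrite !mulmxDr !mulmxDl; congr (_ + _ + _).
- by rewrite !mulmxA EG mul1mx -mulmxA -trmx_mul EG trmx1 mulmx1.
- rewrite -scalemxAr -scalemxAl /sym mulmxDr mulmxDl; congr (_ *: (_ + _)).
    rewrite !mulmxA EX -mulmxA -trmx_mul mulmxA EG mul1mx //.
  by rewrite !mulmxA EG mul1mx -mulmxA -trmx_mul EX trmx_mul trmxK.
- by rewrite -scalemxAr -scalemxAl !mulmxA EX -mulmxA -trmx_mul EX.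
Qed.

(** Sorts the congruence by the explicit factors x. *)
Lemma congruence_shift n (V : 'M[R]_(d, n)) (C : 'M[R]_n) (x : 'cV[R]_d) (w : 'cV[R]_n) :
  C^T = C -> (V - x *m w^T) *m C *m (V - x *m w^T)^T =
  V *m C *m V^T - (x *m (V *m C *m w)^T + (V *m C *m w) *m x^T)
  + ((w^T *m C *m w) 0 0) *: (x *m x^T).
Proof.
move=> CS.
have e1 : x *m w^T *m C *m V^T = x *m (V *m C *m w)^T by rewrite !trmx_mul CS !mulmxA.
have e2 : x *m w^T *m C *m (w *m x^T) = ((w^T *m C *m w) 0 0) *: (x *m x^T).
  have -> : x *m w^T *m C *m (w *m x^T) = x *m (w^T *m C *m w) *m x^T by rewrite !mulmxA.
  by rewrite {1}[w^T *m C *m w]mx11_scalar mul_mx_scalar -scalemxAl.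
rewrite linearB /= [(x *m w^T)^T]trmx_mul trmxK mulmxBl mulmxBl !mulmxBr e1 e2 !mulmxA.
move: (V *m C *m V^T) (x *m (V *m C *m w)^T) (V *m C *m w *m x^T) (_ *: _) => a b c e.
by apply/matrixP => i j; rewrite !mxE; ring.
Qed.

(** Each explicit factor x multiplies an affine expression; its value at 0 is moved to the summand
    of lower degree, so that only homogeneous linear factors stay. *)
Lemma bary_field_Sigma1pp b : (forall i j k, b i j k = b j i k) -> Sigma1pp (bary_field v b).
Proof.
move=> bS; pose one : 'cV[R]_d.+1 := const_mx 1.
pose C := coef_mx b; pose V := vertices.
pose u0 := V *m C 0 *m one.
pose s x := (one^T *m C x *m one) 0 0.
(* The -2 cancels the half in [sym] and gives the sign of the mixed terms; [s 0 *: x] accounts for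
   s(0) x x^T. *)
pose q x := (- 2) *: (V *m (C x - C 0) *m one) + s 0 *: x.
have CA : affine_mx C by exact: affine_coef_mx.
have C0A : affine_mx (fun x => C x - C 0) by apply/affine_mxD/affine_mx_cst.
have qA : affine_mx q.
  apply/affine_mxD; apply/affine_mxZ; last exact: affine_mx_id.
  exact/affine_mx_mulr/affine_mx_mull.
exists (fun x => V *m C x *m V^T - (x *m u0^T + u0 *m x^T)), (fun x => sym (x *m (q x)^T)),
  (fun x => (s x - s 0) *: (x *m x^T)); split.
- split.
    apply/affine_mxP/affine_mxD; first exact/affine_mx_mulr/affine_mx_mull.
    apply/affine_mxN/affine_mxD; first exact/affine_mx_mulr/affine_mx_id.
    exact/affine_mx_mull/affine_mx_tr/affine_mx_id.
  move=> x; rewrite linearB linearD /= !trmx_mul !trmxK coef_mx_sym // mulmxA.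
  by rewrite [X in _ - X]addrC.
- exists q => // i; apply/Hk1_setT_baryP; split.
    by have /affine_mxP/(_ i 0) := qA.
  by rewrite /q subrr mulmx0 mul0mx !scaler0 addr0 mxE.
- exists (fun x => s x - s 0) => //; apply/Hk1_setT_baryP; split; last by rewrite subrr.
  have sA : affine_mx (fun x => one^T *m C x *m one - one^T *m C 0 *m one).
    apply/affine_mxD; last exact: affine_mx_cst.
    exact/affine_mx_mulr/affine_mx_mull.
  have /affine_mxP/(_ 0 0) := sA; congr (Pk _ _ _).
  by apply/funext => x; rewrite mxE [X in _ + X]mxE.
apply/funext => x; rewrite bary_field_mx -/(C x) /edges -/V.
have -> : const_mx 1 = one^T by rewrite trmx_const.
rewrite congruence_shift ?coef_mx_sym // -/(s x).
have -> : V *m C x *m one = u0 + V *m (C x - C 0) *m one.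
  by rewrite -mulmxDl -mulmxDr addrC subrK.
rewrite -[s x in LHS](subrK (s 0)).
rewrite [RHS](_ : _ = V *m C x *m V^T - (x *m u0^T + u0 *m x^T) + sym (x *m (q x)^T)
  + (s x - s 0) *: (x *m x^T)); last by [].
rewrite /sym /q.
move: (V *m (C x - C 0) *m one) (V *m C x *m V^T) (s x - s 0) (s 0) u0 => u1 M r0 r1 w0.
apply/matrixP => k l; by rewrite !mxE !big_ord1 !mxE; field.
Qed.

End SigmaFields.

(** * Normalized coefficients and their number *)

Section SigmaBasis.
Context {R : realType} {d : nat} (v : 'I_d.+1 -> 'cV[R]_d).
Hypothesis hv : affinely_independent v.
Implicit Types (b : 'I_d.+1 -> 'I_d.+1 -> 'I_d.+1 -> R) (x : 'cV[R]_d).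

(* The coefficients [s i (j == k) + s j (i == k)] give the zero field because
   [sum_k bary v k x *: (v k - x) = 0]; they are used to remove the diagonal. *)
Lemma bary_field_off_diagonal b : (forall i j k, b i j k = b j i k) ->
  exists2 b', bary_field v b' = bary_field v b &
    (forall i j k, b' i j k = b' j i k) /\ forall i, b' i i i = 0.
Proof.
(* At i = j = k the correction is 2 s_i, hence the half. *)
move=> bS; pose s i := b i i i / 2.
exists (fun i j k => b i j k - (s i * (j == k)%:R + s j * (i == k)%:R)); last first.
  split=> [i j k|i]; first by rewrite bS [X in _ - X]addrC.
  by rewrite eqxx !mulr1 /s; field.
apply/funext => x; rewrite !bary_field_mx.
pose S : 'cV[R]_d.+1 := \col_i s i; pose y : 'cV[R]_d.+1 := \col_i bary v i x.
have -> : coef_mx v (fun i j k => b i j k - (s i * (j == k)%:R + s j * (i == k)%:R)) x =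
    coef_mx v b x - (S *m y^T + y *m S^T).
  apply/matrixP => i j; rewrite !mxE !big_ord1 !mxE /coef.
  have pick l : \sum_k (l == k)%:R * bary v k x = bary v l x.
    rewrite (bigD1 l) //= eqxx mul1r big1 ?addr0 // => k.
    by rewrite eq_sym => /negbTE->; rewrite mul0r.
  rewrite -(pick i) -(pick j) mulr_suml mulr_sumr -big_split -sumrB.
  by apply: eq_bigr => k _ /=; ring.
have Ey : edges v x *m y = 0.
  rewrite edges_mul; under eq_bigr => i _ do rewrite mxE.
  by rewrite (bary_edges hv) subrr.
move: (edges v x) Ey => E Ey.
rewrite mulmxBr mulmxBl mulmxDr mulmxDl -!mulmxA -trmx_mul Ey trmx0 !mulmx0.
by rewrite (mulmxA E y) Ey mul0mx addr0 subr0.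
Qed.

Lemma bary_field_sum (I : finType) (P : pred I) (w : I -> R)
    (b : I -> 'I_d.+1 -> 'I_d.+1 -> 'I_d.+1 -> R) :
  bary_field v (fun i j k => \sum_(p | P p) w p * b p i j k) =
  \sum_(p | P p) w p *: bary_field v (b p).
Proof.
apply/funext => x; rewrite fct_sumE.
transitivity (\sum_(p | P p) w p *: bary_field v (b p) x); last by [].
rewrite /bary_field; under [RHS]eq_bigr => p _ do rewrite scaler_sumr.
rewrite [RHS]exchange_big; apply: eq_bigr => i _ /=.
under [RHS]eq_bigr => p _ do rewrite scaler_sumr.
rewrite [RHS]exchange_big; apply: eq_bigr => j _ /=.
rewrite -[X in X = _]/(coef v _ i j x *: _).
have -> : coef v (fun i j k => \sum_(p | P p) w p * b p i j k) i j x =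
    \sum_(p | P p) w p * coef v (b p) i j x.
  rewrite /coef; under eq_bigr => k _ do rewrite mulr_suml.
  rewrite exchange_big; apply: eq_bigr => p _ /=; rewrite mulr_sumr.
  by apply: eq_bigr => k _; rewrite mulrA.
by rewrite scaler_suml; apply: eq_bigr => p _; rewrite scalerA.
Qed.

(* The coefficients that remain by symmetry and after the removal of the diagonal. *)
Definition free_index : {set 'I_d.+1 * 'I_d.+1 * 'I_d.+1} :=
  [set p : 'I_d.+1 * 'I_d.+1 * 'I_d.+1 |
    (p.1.1 < p.1.2)%N || (p.1.1 == p.1.2) && (p.2 != p.1.1)].

(** The indicator of p made symmetric in i, j: it is 1 at p when its first two indices agree, and
    otherwise 1/2 at p and at its transpose. *)
Definition unit_coef (p : 'I_d.+1 * 'I_d.+1 * 'I_d.+1) (i j k : 'I_d.+1) : R :=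
  2^-1 * ((p == (i, j, k))%:R + (p == (j, i, k))%:R).

Lemma sum_unit_coef (c : 'I_d.+1 * 'I_d.+1 * 'I_d.+1 -> R) i j k :
  \sum_(p in free_index) c p * unit_coef p i j k =
  2^-1 * ((if (i, j, k) \in free_index then c (i, j, k) else 0)
        + (if (j, i, k) \in free_index then c (j, i, k) else 0)).
Proof.
have pick q : \sum_(p in free_index) c p * (p == q)%:R = if q \in free_index then c q else 0.
  case: ifP => qK.
    rewrite (bigD1 q) //= eqxx mulr1 big1 ?addr0 // => p /andP[_ /negbTE->].
    by rewrite mulr0.
  rewrite big1 // => p pK; case: eqP => [pq|_]; last by rewrite mulr0.
  by rewrite -pq pK in qK.
rewrite -!pick -big_split mulr_sumr; apply: eq_bigr => p _ /=.
by rewrite /unit_coef; ring.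
Qed.

Lemma free_indexE i j k :
  ((i, j, k) \in free_index) = (i < j)%N || (i == j) && (k != i).
Proof. by rewrite inE. Qed.

(** Each pair i < j leaves d + 1 choices of k, and each i = j leaves d. *)
Lemma card_free_index : (#|free_index| = 'C(d.+1, 2) * d.+1 + d.+1 * d)%N.
Proof.
pose n := d.+1; pose lt (i j : 'I_n) := nat_of_bool (i < j)%N.
have -> : #|free_index| = (\sum_i \sum_j (lt i j * n + (i == j) * d))%N.
  transitivity (\sum_(q : 'I_n * 'I_n) \sum_(k : 'I_n)
      if (q, k) \in free_index then 1 else 0)%N.
    rewrite pair_bigA /= -sum1_card big_mkcond /=.
    by apply: eq_bigr => -[q k] _.
  rewrite [RHS]pair_bigA /=; apply: eq_bigr => -[i j] _ /=.
  rewrite -big_mkcond sum1_card /lt; case: (ltngtP i j) => /= ij.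
  - have -> : (i == j) = false by apply: contraTF ij => /eqP->; rewrite ltnn.
    rewrite mul1n addn0 -[RHS]card_ord; apply: eq_card => k.
    by rewrite -[LHS]/((i, j, k) \in free_index) free_indexE ij inE.
  - have -> : (i == j) = false by apply: contraTF ij => /eqP->; rewrite ltnn.
    rewrite mul0n addn0; apply: eq_card0 => k.
    rewrite -[LHS]/((i, j, k) \in free_index) free_indexE ltnNge (ltnW ij) /=.
    by apply/negbTE; rewrite negb_and; apply/orP; left; apply: contraTneq ij => ->; rewrite ltnn.
  - have -> : i = j by exact: val_inj.
    rewrite eqxx mul0n mul1n add0n; transitivity #|predC1 j|; last by rewrite cardC1 card_ord.
    apply: eq_card => k.
    by rewrite -[LHS]/((j, j, k) \in free_index) free_indexE ltnn eqxx inE.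
(* By trichotomy, pairs in increasing order, in decreasing order and on the diagonal exhaust all n^2
   pairs. *)
have lt2 : (2 * (\sum_i \sum_j lt i j) + n = n * n)%N.
  have e : (\sum_i \sum_j (lt i j + lt j i + (i == j)) = n * n)%N.
    rewrite (eq_bigr (fun=> n)) ?sum_nat_const ?card_ord // => i _.
    rewrite (eq_bigr (fun=> 1%N)) ?sum1_card ?card_ord // => j _.
    by rewrite /lt -val_eqE /=; case: ltngtP.
  rewrite -[RHS]e; under [RHS]eq_bigr => i _ do rewrite !big_split.
  rewrite !big_split /= mul2n -addnn; congr (_ + _ + _)%N; first by rewrite exchange_big.
  rewrite (eq_bigr (fun=> 1%N)) ?sum1_card ?card_ord // => i _.
  rewrite (bigD1 i) //= eqxx big1 // => j /negbTE.
  by rewrite eq_sym => ->.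
have bin : (2 * 'C(n, 2) = n * d)%N by rewrite -mul_bin_diag bin1.
have <- : (\sum_i \sum_j lt i j = 'C(n, 2))%N.
  by move: lt2 bin; rewrite /n; move: (\sum_i _)%N 'C(_, _) => x y; nia.
rewrite big_distrl -[X in (_ + X * d)%N]card_ord -sum_nat_const -big_split /=.
apply: eq_bigr => i _; rewrite big_split -big_distrl /=; congr (_ + _)%N.
rewrite (bigD1 i) //= eqxx mul1n big1 ?addn0 // => j /negbTE.
by rewrite eq_sym => ->.
Qed.

End SigmaBasis.

(** * Dimension of the space of shape functions *)

Section Dimension.
Context {R : realType} {d : nat} (v : 'I_d.+1 -> 'cV[R]_d).
Hypotheses (hv : affinely_independent v) (d1 : (1 < d)%N).
Implicit Types (b : 'I_d.+1 -> 'I_d.+1 -> 'I_d.+1 -> R).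

Lemma bary_field0 b : (forall i j k, b i j k = 0) -> bary_field v b = 0.
Proof.
move=> b0; apply/funext => x; apply: big1 => i _; apply: big1 => j _.
by rewrite /coef big1 ?scale0r // => k _; rewrite b0 mul0r.
Qed.

(** A zero field is also the field of the zero coefficients [z], whose traces vanish by the trace
    formulas; the traces determine normalized coefficients. *)
Lemma bary_field_eq0 b : (forall i j k, b i j k = b j i k) -> (forall i, b i i i = 0) ->
  bary_field v b = 0 -> forall i j k, b i j k = 0.
Proof.
move=> bS bii b0; have d0 : (0 < d)%N by exact: ltnW.
pose z (i j k : 'I_d.+1) : R := 0.
have c0 i j x : coef v z i j x = 0 by apply: big1 => k _; rewrite mul0r.
have {}b0 : bary_field v b = bary_field v z by rewrite b0 bary_field0.
apply: (field_traces_eq0 hv d1 bS bii) => [i j k ij kij|i k ki|i k ki]; rewrite b0.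
- have [h _ [s [t ->]]] := tr_e_edge hv (b := z) d1 ij (fun _ _ _ => erefl).
    by rewrite !c0 !mulr0 !addr0.
  by apply: hull_vertex; rewrite inE.
- have [h _ ->] := tr_nn_facet hv z i d0; first by rewrite c0 mulr0.
  by apply: hull_vertex; rewrite !inE.
- have [h _ [c cE ->]] := tr_2_facet hv (b := z) i d0 (fun _ _ _ => erefl).
    rewrite cE // big1 => [|l _]; last exact: c0.
    by rewrite big1 ?mulr0 ?subrr ?mulr0 ?addr0.
  by apply: hull_vertex; rewrite !inE.
Qed.

Lemma Sigma1pp_dim : has_dim (@Sigma1pp R d) #|@free_index d|.
Proof.
have sumE c : \sum_(p in free_index) c p *: bary_field v (@unit_coef R d p) =
    bary_field v (fun i j k => \sum_(p in free_index) c p * unit_coef p i j k).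
  by rewrite bary_field_sum.
have symE (c : 'I_d.+1 * 'I_d.+1 * 'I_d.+1 -> R) i j k :
    \sum_(p in free_index) c p * unit_coef p i j k =
    \sum_(p in free_index) c p * unit_coef p j i k.
  by rewrite !sum_unit_coef addrC.
apply: (has_dim_family (e := fun p => bary_field v (unit_coef p))) => [c|tau].
  rewrite sumE => z0 [[i j] k] ijk.
  (* The triples (l, l, l) are outside [free_index], so the combined coefficients are normalized. *)
  have diag l : \sum_(p in free_index) c p * unit_coef p l l l = 0.
    have lK : (l, l, l) \notin free_index by rewrite free_indexE ltnn eqxx.
    by rewrite sum_unit_coef (negbTE lK) addr0 mulr0.
  have h := bary_field_eq0 (symE c) diag z0 i j k; rewrite sum_unit_coef ijk in h.
  move: ijk h; rewrite !free_indexE => /orP[ij|/andP[/eqP-> kj]].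
    have -> : (j == i) = false by apply: contraTF ij => /eqP->; rewrite ltnn.
    by rewrite ltnNge (ltnW ij) /= addr0; lra.
  by rewrite ltnn eqxx kj /=; lra.
split=> [/(Sigma1pp_bary_field hv)[b bS ->]|[c ->]]; last first.
  by rewrite sumE; apply: (bary_field_Sigma1pp hv) => i j k; exact: symE.
have [b' <- [b'S b'0]] := bary_field_off_diagonal hv bS.
(* The 2 undoes the half in [unit_coef] for distinct i and j. *)
exists (fun p => if p.1.1 == p.1.2 then b' p.1.1 p.1.2 p.2 else 2 * b' p.1.1 p.1.2 p.2).
rewrite sumE; congr bary_field; apply/funext => i; apply/funext => j; apply/funext => k.
rewrite sum_unit_coef !free_indexE /=.
have [<-|ij] := eqVneq i j.
  rewrite ltnn /=; case: eqVneq => [->|_] /=; first by rewrite b'0 addr0 mulr0.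
  by field.
rewrite /= !orbF; case: (ltngtP i j) => [ij'|ij'|/val_inj e].
- by rewrite addr0; field.
- by rewrite add0r b'S; field.
- by rewrite e eqxx in ij.
Qed.

End Dimension.

(** * Number of the functionals, and unisolvence *)

Lemma card_subsimplex d l : #|{: subsimplex d l}| = 'C(d.+1, l.+1).
Proof.
rewrite card_sig -[in RHS](card_ord d.+1) -card_draws.
by apply: eq_card => A; rewrite !inE.
Qed.

(** Both sides equal d (d + 1) (d + 3) / 2. The factors d.-2.+1 and d.-1.+1 are the vertex numbers
    of the faces, hence the dimensions of the test spaces. *)
Lemma card_dofs d : (1 < d)%N ->
  ('C(d.+1, d.-2.+1) * d.-2.+1 + ('C(d.+1, d.-1.+1) * d.-1.+1 + 'C(d.+1, d.-1.+1) * d.-1.+1) =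
   'C(d.+1, 2) * d.+1 + d.+1 * d)%N.
Proof.
case: d => [|[|d]] //= _; rewrite binSn.
have -> : 'C(d.+3, d.+1) = 'C(d.+3, 2) by rewrite -[RHS]bin_sub.
have := mul_bin_diag d.+3 1; rewrite bin1 /=.
by move: (binomial _ _) => x; lia.
Qed.

Theorem lemma2p11 (R : realType) (d : nat) (hd : (2 <= d)%N)
    (v : 'I_d.+1 -> 'cV[R]_d) (hv : affinely_independent v) :
  unisolvent (@Sigma1pp R d) (dof_space v) (dof v).
Proof.
split=> [[[e|F]|F]|m b hb]; try by exists #|val e|; exact: Pk1_hull_basis.
- by exists #|val F|; exact: Pk1_hull_basis.
- by exists #|val F|; exact: Pk1_hull_basis.
(* The given bases are arbitrary; comparison with the barycentric one yields their sizes. *)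
have size_basis A n (c : 'I_n -> 'cV[R]_d -> R) : is_basis (Pk 1 (hull v A)) c -> n = #|A|.
  by have [c' hc'] := Pk1_hull_basis hv A => hc; exact: is_basis_unique_size hc hc'.
split.
  have -> : (\sum_j m j = #|@free_index d|)%N.
    rewrite !big_sumType /=.
    have e0 e : m (inl (inl e)) = d.-2.+1.
      by rewrite (size_basis _ _ _ (hb (inl (inl e)))); apply/eqP; exact: valP e.
    have e1 F : m (inl (inr F)) = d.-1.+1.
      by rewrite (size_basis _ _ _ (hb (inl (inr F)))); apply/eqP; exact: valP F.
    have e2 F : m (inr F) = d.-1.+1.
      by rewrite (size_basis _ _ _ (hb (inr F))); apply/eqP; exact: valP F.
    under eq_bigr => e _ do rewrite e0.
    under [X in (_ + X + _)%N]eq_bigr => F _ do rewrite e1.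
    under [X in (_ + X)%N]eq_bigr => F _ do rewrite e2.
    rewrite !sum_nat_const !card_subsimplex card_free_index.
    by rewrite -addnA card_dofs.
  exact: (Sigma1pp_dim hv hd).
move=> _ /(Sigma1pp_bary_field hv)[b0 b0S ->].
(* Normalizing leaves tau unchanged and makes its coefficients determined by the traces. *)
have [b1 <- [b1S b1d]] := bary_field_off_diagonal hv b0S.
move=> hdof; apply: bary_field0; have d0 : (0 < d)%N by exact: ltnW.
have card1 (i : 'I_d.+1) : #|~: [set i]| == d.-1.+1.
  by have := cardsC [set i]; rewrite cards1 card_ord prednK //; lia.
apply: (field_traces_eq0 hv hd b1S b1d) => [i j k ij kij|i k ki|i k ki].
- have card2 : #|~: [set i; j]| == d.-2.+1.
    by have := cardsC [set i; j]; rewrite cards2 ij card_ord; lia.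
  pose e : subsimplex d d.-2 := exist _ (~: [set i; j]) card2.
  (* The trace formula holds on the face itself, which is enough for vanishing moments to give
     vanishing vertex values. *)
  have eA : affine_on v (~: [set i; j]) (tr_e v (~: [set i; j]) (bary_field v b1)).
    have [h _ [s [t hE]]] := tr_e_edge hv hd ij b1S.
    apply: (affine_on_ext (g := fun x =>
      h * coef v b1 i j x + s * coef v b1 i i x + t * coef v b1 j j x) hE).
    apply: affine_onD; last exact/affine_onZ/affine_on_coef.
    by apply: affine_onD; exact/affine_onZ/affine_on_coef.
  apply: (L2_affine_eq0 (A := e) hv eA (hb (inl (inl e)))) => [l|]; last by rewrite inE.
  exact: hdof (inl (inl e)) l.
- pose F : subsimplex d d.-1 := exist _ (~: [set i]) (card1 i).
  have FA : affine_on v (~: [set i]) (tr_nn v (~: [set i]) (bary_field v b1)).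
    have [h _ hE] := tr_nn_facet hv b1 i d0.
    apply: (affine_on_ext (g := fun x => h * coef v b1 i i x) hE).
    exact/affine_onZ/affine_on_coef.
  apply: (L2_affine_eq0 (A := F) hv FA (hb (inl (inr F)))) => [l|]; last by rewrite !inE.
  exact: hdof (inl (inr F)) l.
- pose F : subsimplex d d.-1 := exist _ (~: [set i]) (card1 i).
  have FA : affine_on v (~: [set i]) (tr_2 v (~: [set i]) (bary_field v b1)).
    have [h _ [c _ hE]] := tr_2_facet hv i d0 b1S.
    apply: (affine_on_ext (g := fun x =>
      h * (d.+1%:R * (\sum_l coef v b1 i l x) - \sum_l b1 i l l) + c) hE).
    apply/affine_onD/affine_on_cst/affine_onZ/affine_onD.
      by apply/affine_onZ/affine_on_sum => l; exact: affine_on_coef.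
    exact: affine_on_cst.
  apply: (L2_affine_eq0 (A := F) hv FA (hb (inr F))) => [l|]; last by rewrite !inE.
  exact: hdof (inr F) l.
Qed.
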